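(* Let $A_1,\dots,A_c$ be simple undirected graphs on vertex set $[n]$ such that the sum graph $H=A_1+\cdots+A_c$ is connected and each $\underline{A}_j$ is nonempty and connected, and let $X=A_1\boxplus\cdots\boxplus A_c$ be their additive product. Then all roots of the additive characteristic polynomial $\alpha(A_1,\dots,A_c;x)$ lie in the interval $[-\rho(X),\rho(X)]$.
   Context: Graphs are identified with their adjacency matrices. The sum graph $A_1+\cdots+A_c$ is the multigraph whose adjacency matrix is the sum of the adjacency matrices. $\underline{A}_j$ denotes $A_j$ with isolated vertices removed. Additive characteristic polynomial: a cycle on $[n]$ is a closed walk $v_0v_1\cdots v_t=v_0$ of length $t\ge1$ with $v_0,\dots,v_{t-1}$ distinct, considered as a set of arcs $(v_i,v_{i+1})$, with starting point forgotten ($i\to j\to i$ with $i\ne j$ is a cycle of length 2). A colored cycle is a pair $\tilde\gamma=(\gamma,j)$ with $\gamma$ a cycle on $[n]$ and $j\in[c]$; its weight is $w(\tilde\gamma)=\prod_{(a,b)\in\gamma}(A_j)_{ab}$ and its length is $\ell(\tilde\gamma)=\ell(\gamma)$. A trivial heap $M$ is a (possibly empty) set of pairwise vertex-disjoint colored cycles of nonzero weight; $\ell(M)=\sum_{\tilde\gamma\in M}\ell(\tilde\gamma)$, $w(M)=\prod_{\tilde\gamma\in M}w(\tilde\gamma)$, $|M|$ is the number of colored cycles. Then $\alpha(A_1,\dots,A_c;x)=\sum_{k=0}^n b_kx^{n-k}$ with $b_k=\sum_{M:\ \ell(M)=k}(-1)^{|M|}w(M)$. Additive product: fix $v_1\in[n]$.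 The graph $A_1\boxplus\cdots\boxplus A_c$ has as vertex set $V$ the strings $v_1C_1v_2C_2\cdots v_kC_kv_{k+1}$, $k\ge0$, with $v_i\in[n]$, $C_i\in[c]$, $C_i\ne C_{i+1}$ for $i<k$, and $v_i\neq v_{i+1}$ both vertices of $\underline{A}_{C_i}$ for $i\le k$; its edges are all pairs of elements of $V$ of the following forms ($s$ a string in $V$): $\{sCu,sCv\}$ with $\{u,v\}$ an edge of $\underline{A}_C$; $\{sCu,sCuC'v\}$ with $\{u,v\}$ an edge of $\underline{A}_{C'}$; and $\{v_1,v_1Cv\}$ with $\{v_1,v\}$ an edge of $\underline{A}_C$. Up to isomorphism it does not depend on $v_1$. Spectral radius: $\rho(X)=\limsup_{t\to\infty}(c_{uv}^{(t)})^{1/t}$, where $c_{uv}^{(t)}$ is the number of walks of length $t$ in $X$ from $u$ to $v$ (independent of the choice of $u,v$). *)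

(* Defs.v *)
From HB Require Import structures.
From mathcomp Require Import all_boot all_order all_algebra finmap.
From mathcomp Require Import all_classical all_reals all_analysis.
From mathcomp Require Import complex.

Set Implicit Arguments.
Unset Strict Implicit.
Unset Printing Implicit Defensive.

Import Order.TTheory GRing.Theory Num.Theory.
Local Open Scope classical_set_scope.
Local Open Scope ring_scope.

(* A graph on 'I_n is identified with its integer adjacency matrix. *)

Definition edge n (A : 'M[int]_n) : rel 'I_n := fun u v => A u v != 0.

Definition simple_graph n (A : 'M[int]_n) : Prop :=
  [/\ forall u v, A u v = 0 \/ A u v = 1,
      forall u v, A u v = A v u
    & forall u, A u u = 0].

Definition connected_graph n (A : 'M[int]_n) : Prop :=
  forall u v, connect (edge A) u v.

Definition nonisolated n (A : 'M[int]_n) : {set 'I_n} :=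
  [set v | [exists u, edge A u v]].

(* The subgraph of A induced on S. *)
Definition induced_edge n (A : 'M[int]_n) (S : {set 'I_n}) : rel 'I_n :=
  fun u v => [&& u \in S, v \in S & edge A u v].

Definition underline_nonempty_connected n (A : 'M[int]_n) : Prop :=
  nonisolated A != finset.set0 /\
  {in nonisolated A &,
    forall u v, connect (induced_edge A (nonisolated A)) u v}.

(* A cycle on 'I_n is its set of arcs; s lists v_0, ..., v_(t-1), and
   [next s] is the cyclic successor, so a singleton s gives a loop. *)
Definition is_cycle n (g : {set 'I_n * 'I_n}) : bool :=
  [exists t : 'I_n, [exists s : t.+1.-tuple 'I_n,
    uniq s && (g == [set (x, next s x) | x in s]%SET)]].

Definition colored_cycle c n : finType := ({set 'I_n * 'I_n} * 'I_c)%type.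

Definition cycle_vertices c n (x : colored_cycle c n) : {set 'I_n} :=
  [set a.1 | a in x.1]%SET.

(* A cycle has as many arcs as its length. *)
Definition cycle_length c n (x : colored_cycle c n) : nat := #|x.1|.

Definition cycle_weight c n (A : 'I_c -> 'M[int]_n) (x : colored_cycle c n) :
  int := \prod_(a in x.1) A x.2 a.1 a.2.

Definition trivial_heap c n (A : 'I_c -> 'M[int]_n)
    (M : {set colored_cycle c n}) : bool :=
  [forall x in M, is_cycle x.1 && (cycle_weight A x != 0)] &&
  [forall x in M, forall y in M,
     (x != y) ==> [disjoint cycle_vertices x & cycle_vertices y]].

Definition heap_length c n (M : {set colored_cycle c n}) : nat :=
  (\sum_(x in M) cycle_length x)%N.

Definition heap_weight c n (A : 'I_c -> 'M[int]_n)
    (M : {set colored_cycle c n}) : int :=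
  \prod_(x in M) cycle_weight A x.

Definition additive_char_coef c n (A : 'I_c -> 'M[int]_n) (k : nat) : int :=
  \sum_(M : {set colored_cycle c n} | trivial_heap A M && (heap_length M == k))
    (-1) ^+ #|M| * heap_weight A M.

Definition additive_char_poly c n (A : 'I_c -> 'M[int]_n) : {poly int} :=
  \sum_(k < n.+1) additive_char_coef A k *: 'X^(n - k).

(* The string v_1 C_1 v_2 ... C_k v_(k+1) with v_1 fixed is encoded as
   [:: (C_1, v_2); ...; (C_k, v_(k+1))]; in particular v_1 itself is [::]. *)
Fixpoint valid_steps c n (A : 'I_c -> 'M[int]_n) (v : 'I_n)
    (s : seq ('I_c * 'I_n)) : bool :=
  if s is (C, w) :: s' then
    [&& v != w, v \in nonisolated (A C), w \in nonisolated (A C)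
      & valid_steps A w s']
  else true.

Definition valid_string c n (A : 'I_c -> 'M[int]_n) (v1 : 'I_n)
    (s : seq ('I_c * 'I_n)) : bool :=
  sorted (fun C D => C != D) (unzip1 s) && valid_steps A v1 s.

Definition product_vertex c n (A : 'I_c -> 'M[int]_n) (v1 : 'I_n) :
  choiceType := {s : seq ('I_c * 'I_n) | valid_string A v1 s}.

Inductive product_arc c n (A : 'I_c -> 'M[int]_n) (v1 : 'I_n) :
    seq ('I_c * 'I_n) -> seq ('I_c * 'I_n) -> Prop :=
| arc_same_copy s C u v of edge (A C) u v :
    product_arc A v1 (rcons s (C, u)) (rcons s (C, v))
| arc_new_copy s C u C' v of edge (A C') u v :
    product_arc A v1 (rcons s (C, u)) (rcons (rcons s (C, u)) (C', v))
| arc_root C v of edge (A C) v1 v :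
    product_arc A v1 [::] [:: (C, v)].

Definition additive_product c n (A : 'I_c -> 'M[int]_n) (v1 : 'I_n) :
  rel (product_vertex A v1) :=
  fun x y => `[< product_arc A v1 (val x) (val y) \/
                 product_arc A v1 (val y) (val x) >].

Definition walks (V : choiceType) (e : rel V) (u v : V) (t : nat) :
  set (seq V) := [set w | [/\ size w = t, path e u w & last u w = v]].

(* [fset_set] is the empty set on infinite arguments; for a locally finite
   graph, such as the additive product, [walks] is always finite. *)
Definition num_walks (V : choiceType) (e : rel V) (u v : V) (t : nat) : nat :=
  #|` fset_set (walks e u v t)|.

(* [limn_sup] is real-valued; it is meaningful because the sequence is bounded
   when e has bounded degree, as the additive product does. *)
Definition spectral_radius (R : realType) (V : choiceType) (e : rel V)
    (u v : V) : R :=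
  limn_sup (fun t : nat => (num_walks e u v t)%:R `^ (t%:R^-1)).

(* Main.v *)
Require Import Defs.
From HB Require Import structures.
From mathcomp Require Import all_boot all_order all_algebra.
From mathcomp Require Import all_classical all_reals all_analysis.
From mathcomp Require Import complex finmap ring lra.
From mathcomp Require Import fintype finset bigop.

(** Write [h(U)] for the sum of [(-1)^|M| w(M)] times the product of the
    variables of the uncovered vertices, over the trivial heaps [M] inside [U].
    The polynomial is [h] of the full vertex set with all variables equal to
    [z], so the claim is that [h] does not vanish when [z] is not real, nor when
    [z] is real with [`|z|] larger than the spectral radius.

    The common tool is a recursion. At most one cycle of a heap covers a given
    vertex [v], and such a cycle is a self-avoiding path leaving [v] and coming
    back, so [h(U)] equals [x_v h(U - v)] minus a sum over closed self-avoiding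
    paths [p] of weight times [h(U - p)]. The auxiliary sums [path_sum] over
    paths with prescribed ends obey a similar recursion on the first step. For a
    single matrix this is the Schur complement formula for a determinant.

    Zeros are real. For one colour, [path_sum / h] solves the linear system of
    the symmetric matrix [diag(x) - A_j]; the energy identity for this system
    shows that [h(U) / h(U - v)] has positive imaginary part if all variables do
    ([path_sum_resolves]). For several colours, the coefficients of [h] are the
    convolution over disjoint vertex sets of those of the colours
    ([heap_coef_setU1]), and a convolution of multi-affine polynomials arises by
    identifying, one vertex at a time, the two variables of this vertex in the
    product. In one pair of variables this replaces [a y z + b y + c z + d] by
    [a x + b + c], and the zero of the latter is the sum of the two zeros of the
    quadratic [a y y + (b + c) y + d], so no zero enters the upper half-plane
    ([merge_variables], [stable_convolution]).

    Zeros are bounded. Let [r] lie strictly between the spectral radius and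
    [`|z|]. The Green function [F] at [r] of the additive product (the
    generating function of the walks to a fixed vertex) is positive, and the sum
    of [F] over the neighbours of a vertex [y] is at most [r F(y)]. By induction
    on [U], for every copy of some [A_j] in the product, the absolute values of
    the path sums that lead from [u] out of [U], weighted by [F] at their ends in
    this copy, add up to at most [`|h(U)| F(u)]. The point is that each neighbour
    of [u] in the product is used once: the paths in the copy, including those
    that close up at [u], use the neighbours in it, and the terms of the other
    colours in the recursion for [h(U)] use the neighbours in the other copies
    through [u].
    What the recursion leaves over is
    [`|h(U)| F(u) >= (`|z| - r) `|h(U - u)| F(u)], whence [h(U) != 0]
    ([supersolution_neq0]). *)

Set Implicit Arguments.
Unset Strict Implicit.
Unset Printing Implicit Defensive.

Import Order.TTheory GRing.Theory Num.Theory.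
Import numFieldNormedType.Exports.
Local Open Scope ring_scope.
Local Open Scope complex_scope.

(** * Cycles through a vertex as self-avoiding paths *)

Section SelfAvoiding.
Variable n : nat.
Implicit Types (U : {set 'I_n}) (u v w : 'I_n) (s p : seq 'I_n).

(** Listing the self-avoiding paths of [U] makes sums over them obey a recursion
    on the first vertex; [m] bounds the number of vertices left. *)
Fixpoint saw (m : nat) U : seq (seq 'I_n) :=
  if m is m'.+1 then [::] :: [seq u :: s | u <- enum U, s <- saw m' (U :\ u)]
  else [:: [::]].

Definition self_avoiding U := saw #|U| U.

Lemma mem_saw m U s : (#|U| <= m)%N ->
  (s \in saw m U) = uniq s && all (fun x => x \in U) s.
Proof.
elim: m U s => [|m IHm] U s leUm /=.
  have U0 : U = set0 by apply/eqP; rewrite -cards_eq0 -leqn0.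
  case: s => [|x s] //=; rewrite inE; apply/esym/negbTE.
  by rewrite U0 in_set0 /= andbF.
rewrite inE; case: s => [|x s] //=.
apply/allpairsPdep/idP => [[u [t [uU tS [-> ->]]]]|].
  rewrite mem_enum in uU; move: tS; rewrite IHm; last first.
    by rewrite -ltnS (leq_trans _ leUm) // [#|U|](cardsD1 u) uU.
  case/andP=> -> /allP tU; rewrite uU /= andbT; apply/andP; split.
    by apply/negP => /tU; rewrite !inE eqxx.
  by apply/allP => y /tU /setD1P[].
case/andP=> /andP[xs us] /andP[xU /allP sU]; exists x, s; split=> //.
  by rewrite mem_enum.
rewrite IHm ?us /=; last first.
  by rewrite -ltnS (leq_trans _ leUm) // [#|U|](cardsD1 x) xU.
apply/allP => y ys; rewrite !inE sU // andbT.
by apply: contraNneq xs => <-.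
Qed.

Lemma saw_uniq m U : uniq (saw m U).
Proof.
elim: m U => [|m IHm] U //=; apply/andP; split.
  by apply/allpairsPdep => [[u [t [_ _]]]].
apply: allpairs_uniq_dep => [|u _|]; rewrite ?enum_uniq //.
by move=> [u s] [w t] _ _ /= [-> ->].
Qed.

Lemma mem_self_avoiding U s :
  (s \in self_avoiding U) = uniq s && all (fun x => x \in U) s.
Proof. exact: mem_saw. Qed.

Lemma sum_self_avoiding (K : nmodType) U (F : seq 'I_n -> K) :
  \sum_(s <- self_avoiding U) F s =
  F [::] + \sum_(u in U) \sum_(s <- self_avoiding (U :\ u)) F (u :: s).
Proof.
rewrite /self_avoiding; case EU: #|U| => [|m] /=.
  have U0 : U = set0 by apply/eqP; rewrite -cards_eq0 EU.
  by rewrite big_seq1 U0 big_set0 addr0.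
rewrite big_cons; congr (_ + _).
rewrite big_allpairs_dep big_enum /=; apply: eq_bigr => u uU.
by have -> : #|U :\ u| = m by move: EU; rewrite (cardsD1 u) uU => -[].
Qed.

Definition cyc p : {set 'I_n * 'I_n} := [set (x, next p x) | x in p].

Definition arcs_vertices (g : {set 'I_n * 'I_n}) : {set 'I_n} :=
  [set a.1 | a in g].

Lemma arcs_vertices_cyc p : arcs_vertices (cyc p) = [set x in p].
Proof.
apply/setP => x; rewrite inE; apply/imsetP/idP => [[a /imsetP[y yp ->] ->]|xp] //.
by exists (x, next p x) => //; apply/imsetP; exists x.
Qed.

(** Both lists are the trajectory of [v] under the successor function that the
    set of arcs encodes. *)
Lemma cyc_inj v : {in [pred s | uniq (v :: s)] &,
  injective (fun s => cyc (v :: s))}.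
Proof.
move=> s t us ut eq_st; rewrite !inE in us ut.
have sz_st : size s = size t.
  have card_cyc p : uniq p -> #|cyc p| = size p.
    by move=> up; rewrite card_imset ?(card_uniqP up) // => x y [].
  by move: (card_cyc _ us); rewrite eq_st (card_cyc _ ut) => -[].
have eq_next : {in v :: s, next (v :: s) =1 next (v :: t)}.
  move=> x xs; have : (x, next (v :: s) x) \in cyc (v :: s).
    by apply/imsetP; exists x.
  by rewrite eq_st => /imsetP[y _ /eqP]; rewrite xpair_eqE => /andP[/eqP-> /eqP->].
have ps : fpath (next (v :: s)) v s.
  by move: (cycle_next us) => /=; rewrite rcons_path => /andP[].
have pt : fpath (next (v :: t)) v t.
  by move: (cycle_next ut) => /=; rewrite rcons_path => /andP[].
rewrite (fpathE pt) -sz_st.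
suff: fpath (next (v :: t)) v s by move/fpathE.
apply: sub_in_path ps; last exact/allP/(fun x xs => xs).
by move=> x y xs _ /eqP <-; apply/eqP/esym/eq_next.
Qed.

Lemma is_cycleP (g : {set 'I_n * 'I_n}) v : v \in arcs_vertices g ->
  reflect (exists2 s, uniq (v :: s) & g = cyc (v :: s)) (is_cycle g).
Proof.
move=> vg; apply: (iffP existsP) => [[t /existsP[p /andP[up /eqP gE]]]|[s us gE]].
  have vp : v \in val p.
    by move: vg; rewrite gE => /imsetP[a /imsetP[x xp ->] ->].
  have [i s rotp] := rot_to vp.
  exists s; first by rewrite -rotp rot_uniq.
  have nextE : next (v :: s) =1 next p by rewrite -rotp; exact: next_rot.
  have memE : v :: s =i p by move=> x; rewrite -rotp mem_rot.
  rewrite gE; apply/setP => a; apply/imsetP/imsetP => -[x xp ->]; exists x;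
    by rewrite ?nextE ?memE // -memE.
have ltn : (size s < n)%N.
  by have := max_card (mem (v :: s)); rewrite card_ord (card_uniqP us).
exists (Ordinal ltn); apply/existsP.
by exists (in_tuple (v :: s)); apply/andP; split; [exact: us | rewrite gE].
Qed.

(** Cutting a cycle at [v] leaves a self-avoiding path, which the cycle
    determines since its starting point [v] is prescribed. *)
Lemma sum_cycles (K : nmodType) U v (F : {set 'I_n * 'I_n} -> K) : v \in U ->
  \sum_(g | [&& is_cycle g, v \in arcs_vertices g & arcs_vertices g \subset U])
     F g = \sum_(s <- self_avoiding (U :\ v)) F (cyc (v :: s)).
Proof.
move=> vU.
rewrite -[LHS]big_filter -(big_map (fun s => cyc (v :: s)) predT F).
apply: perm_big; apply: uniq_perm.
- by rewrite filter_uniq // index_enum_uniq.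
- rewrite map_inj_in_uniq ?saw_uniq // => s t sS tS.
  suff H r : r \in self_avoiding (U :\ v) -> r \in [pred s | uniq (v :: s)].
    by apply: cyc_inj; apply: H.
  rewrite mem_self_avoiding inE /= => /andP[-> /allP rU]; rewrite andbT.
  by apply/negP => /rU; rewrite !inE eqxx.
move=> g; rewrite mem_filter mem_index_enum andbT.
apply/and3P/mapP => [[cg vg gU]|[s sS ->]].
  have [s us gE] := is_cycleP vg cg; exists s => //.
  move: us; rewrite cons_uniq mem_self_avoiding => /andP[vs ->]; apply/allP => x xs.
  rewrite !inE; apply/andP; split; first by apply: contraNneq vs => <-.
  by apply: (subsetP gU); rewrite gE arcs_vertices_cyc !inE xs orbT.
move: sS; rewrite mem_self_avoiding => /andP[us /allP sU].
have vs : v \notin s by apply/negP => /sU; rewrite !inE eqxx.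
have vg : v \in arcs_vertices (cyc (v :: s)).
  by rewrite arcs_vertices_cyc !inE eqxx.
split=> //; first by apply/(is_cycleP vg); exists s => //=; rewrite vs.
rewrite arcs_vertices_cyc; apply/subsetP => x; rewrite !inE.
by case/predU1P => [->//|/sU/setD1P[]].
Qed.

Fixpoint path_weight (B : 'M[int]_n) u s v : int :=
  if s is w :: s' then B u w * path_weight B w s' v else B u v.

Lemma prod_cyc (B : 'M[int]_n) v s : uniq (v :: s) ->
  \prod_(a in cyc (v :: s)) B a.1 a.2 = path_weight B v s v.
Proof.
move=> us; rewrite big_imset /=; last by move=> x y _ _ [].
rewrite -(big_uniq _ us).
suff gen f u : fpath f u (rcons s v) ->
    \prod_(x <- u :: s) B (x, f x).1 (x, f x).2 = path_weight B u s v.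
  exact/gen/(cycle_next us).
elim: s {us} u => [|w s IHs] u /=; first by case/andP=> /eqP <- _; rewrite big_seq1.
by case/andP=> /eqP fu /IHs E; rewrite big_cons E fu.
Qed.

End SelfAvoiding.

(** * Removing a vertex from a sum over heaps *)

Section Heaps.
Variables (c n : nat) (A : 'I_c -> 'M[int]_n).
Implicit Types (M : {set colored_cycle c n}) (U W : {set 'I_n}).
Implicit Types (J : {set 'I_c}) (v : 'I_n) (y : colored_cycle c n).

Definition heap_vertices M : {set 'I_n} := \bigcup_(y in M) cycle_vertices y.

Definition heap_in J U M : bool :=
  [&& trivial_heap A M, [forall y in M, y.2 \in J] & heap_vertices M \subset U].

Lemma trivial_heapP M : reflect
  ((forall y, y \in M -> is_cycle y.1 && (cycle_weight A y != 0)) /\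
   (forall y z, y \in M -> z \in M -> y != z ->
      [disjoint cycle_vertices y & cycle_vertices z]))
  (trivial_heap A M).
Proof.
apply: (iffP andP) => -[H1 H2]; split.
- by move=> y yM; apply: (forall_inP H1).
- by move=> y z yM zM; apply/implyP/(forall_inP (forall_inP H2 y yM)).
- by apply/forall_inP.
- by apply/forall_inP => y yM; apply/forall_inP => z zM; apply/implyP/H2.
Qed.

Lemma heap_vertices_sub M y : y \in M -> cycle_vertices y \subset heap_vertices M.
Proof. by move=> yM; apply: bigcup_sup. Qed.

Lemma heap_vertices_setU1 y M : y \notin M ->
  heap_vertices (y |: M) = cycle_vertices y :|: heap_vertices M.
Proof. exact: big_setU1. Qed.

Section Sums.
Variable K : comNzRingType.
Implicit Type x : 'I_n -> K.

Definition heap_term M : K := (-1) ^+ #|M| * (heap_weight A M)%:~R.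

Definition heap_sum J U x : K :=
  \sum_(M | heap_in J U M) heap_term M * \prod_(v in U :\: heap_vertices M) x v.

Lemma heap_term_setU1 y M : y \notin M ->
  heap_term (y |: M) = - (cycle_weight A y)%:~R * heap_term M.
Proof.
move=> yM; rewrite /heap_term /heap_weight cardsU1 yM big_setU1 //= add1n exprS.
by rewrite intrM mulN1r !mulNr mulrCA.
Qed.

Lemma heap_in_setU1 J U y M : y.2 \in J -> is_cycle y.1 ->
    cycle_weight A y != 0 -> cycle_vertices y \subset U ->
    cycle_vertices y != set0 ->
  heap_in J U (y |: M) && (y \notin M) =
  heap_in J (U :\: cycle_vertices y) M.
Proof.
move=> yJ cy wy yU y0; apply/andP/idP.
  case=> /and3P[/trivial_heapP[H1 H2] /forall_inP HJ].
  rewrite /heap_in => HU yM; rewrite heap_vertices_setU1 // in HU.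
  have M_in z : z \in M -> z \in y |: M by move=> zM; rewrite !inE zM orbT.
  apply/and3P; split.
  - by apply/trivial_heapP; split=> [z /M_in /H1 //|z t /M_in zM /M_in]; apply: H2.
  - by apply/forall_inP => z /M_in /HJ.
  rewrite subUset in HU; rewrite subsetD; case/andP: HU => _ -> /=.
  rewrite disjoint_sym; apply/bigcup_disjointP => z zM.
  by apply: H2; rewrite ?setU11 ?M_in //; apply: contraNneq yM => ->.
case/and3P=> /trivial_heapP[H1 H2] /forall_inP HJ; rewrite subsetD => /andP[MU dis].
have yM : y \notin M.
  apply/negP => yM; have [a ay] := set0Pn _ y0.
  by have := disjointFr dis (subsetP (heap_vertices_sub yM) a ay); rewrite ay.
have dy z : z \in M -> [disjoint cycle_vertices z & cycle_vertices y].
  by move=> zM; apply: disjointWl dis; apply: heap_vertices_sub.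
split=> //; apply/and3P; split.
- apply/trivial_heapP; split=> [z /setU1P[->|/H1 //]|z t]; first by rewrite cy wy.
  move=> /setU1P[->|zM] /setU1P[->|tM]; rewrite ?eqxx // => zt.
  + by rewrite disjoint_sym dy.
  + exact: dy.
  + exact: H2.
- by apply/forall_inP => z /setU1P[->|/HJ].
- by rewrite heap_vertices_setU1 // subUset yU.
Qed.

(** A cycle of nonzero weight extends exactly the heaps that avoid its vertices.
    A cycle of zero weight belongs to no heap, and the right-hand side vanishes
    as well. *)
Lemma sum_heaps_with_cycle J U y x : y.2 \in J -> is_cycle y.1 ->
    cycle_vertices y \subset U -> cycle_vertices y != set0 ->
  \sum_(M | heap_in J U M && (y \in M))
     heap_term M * \prod_(v in U :\: heap_vertices M) x v =
  - (cycle_weight A y)%:~R * heap_sum J (U :\: cycle_vertices y) x.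
Proof.
move=> yJ cy yU y0; have [w0|wy] := eqVneq (cycle_weight A y) 0.
  rewrite w0 oppr0 mul0r big_pred0 // => M; apply/negP => /andP[/and3P[]].
  by move=> /trivial_heapP[H1 _] _ _ /H1; rewrite w0 eqxx andbF.
rewrite (reindex_onto (fun M => y |: M) (fun M => M :\ y)) /=; last first.
  by move=> M /andP[_ yM]; rewrite setD1K.
rewrite big_distrr /=; apply: eq_big => [M|M].
  rewrite -(heap_in_setU1 _ yJ) // setU11 andbT; congr (_ && _).
  apply/eqP/idP => [<-|/setU1K //]; first by rewrite setD11.
rewrite setU11 andbT => /andP[_ /eqP EM].
have yM : y \notin M by rewrite -EM setD11.
by rewrite heap_term_setU1 // heap_vertices_setU1 // setDDl -mulrA.
Qed.

(** Either [v] is uncovered and contributes its variable, or exactly one cycle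
    of the heap passes through [v]. *)
Lemma heap_sum_split J U v x : v \in U ->
  heap_sum J U x = x v * heap_sum J (U :\ v) x -
  \sum_(j in J) \sum_(g | [&& is_cycle g, v \in arcs_vertices g
                            & arcs_vertices g \subset U])
     (cycle_weight A (g, j))%:~R * heap_sum J (U :\: arcs_vertices g) x.
Proof.
move=> vU; rewrite {1}/heap_sum (bigID (fun M => v \in heap_vertices M)) /= addrC.
congr (_ + _).
  rewrite big_distrr /=; apply: eq_big => [M|M /andP[_ vM]].
    by rewrite /heap_in subsetD1 -!andbA.
  rewrite (big_setD1 v) /= ?inE ?vM // mulrCA; congr (_ * (_ * _)).
  by rewrite setDDl setUC -setDDl.
transitivity (\sum_(M | heap_in J U M && (v \in heap_vertices M))
   \sum_(y in M | v \in cycle_vertices y)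
   heap_term M * \prod_(v in U :\: heap_vertices M) x v).
  apply: eq_bigr => M /andP[/and3P[/trivial_heapP[_ HM] _ _] /bigcupP[y yM vy]].
  rewrite (bigD1 y) /= ?yM // [X in _ + X]big_pred0 ?addr0 // => z.
  apply/negP => /andP[/andP[zM vz] zy].
  by rewrite (disjointFr (HM _ _ zM yM zy) vz) in vy.
rewrite (exchange_big_dep (fun y => [&& y.2 \in J, is_cycle y.1,
    v \in arcs_vertices y.1 & arcs_vertices y.1 \subset U])) /=; last first.
  move=> M y /andP[/and3P[/trivial_heapP[HM _] /forall_inP HJ HU] _].
  case/andP=> yM vy; rewrite HJ //= vy; case/andP: (HM y yM) => -> _ /=.
  exact: subset_trans (heap_vertices_sub yM) HU.
rewrite -sumrN; under [RHS]eq_bigr do rewrite -sumrN.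
rewrite [RHS]pair_big_dep /=.
rewrite (reindex_onto (fun p => (p.2, p.1)) (fun p => (p.2, p.1))) /=; last by case.
apply: eq_big => [[j g]|[j g]] /=; first by rewrite eqxx andbT.
case/andP=> /and4P[jJ cg vg gU] _.
rewrite -mulNr -[arcs_vertices g]/(cycle_vertices (g, j)).
rewrite -sum_heaps_with_cycle //; last by apply/set0Pn; exists v.
apply: eq_bigl => M; rewrite -andbA; congr (_ && _).
rewrite [v \in cycle_vertices _]vg andbT; apply: andb_idl => yM.
exact: (subsetP (heap_vertices_sub yM)).
Qed.

(** For [H] the heap sum of one colour with matrix [B], that is, a determinant of
    [diag(x) - B] on a set of vertices, Cramer's rule makes
    [path_sum H B U u v / H U] the coordinate [u] of the solution on [U] of the
    system with this matrix and right-hand side column [v] of [B]. *)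
Definition path_sum (H : {set 'I_n} -> K) (B : 'M[int]_n) U u v : K :=
  \sum_(s <- self_avoiding (U :\ u))
     (path_weight B u s v)%:~R * H (U :\ u :\: [set x in s]).

Lemma path_sum_step (H : {set 'I_n} -> K) (B : 'M[int]_n) U u v :
  path_sum H B U u v = (B u v)%:~R * H (U :\ u) +
    \sum_(w in U :\ u) (B u w)%:~R * path_sum H B (U :\ u) w v.
Proof.
rewrite /path_sum sum_self_avoiding; congr (_ * H _ + _) => /=.
  by apply/setP => x; rewrite !inE.
apply: eq_bigr => w _; rewrite big_distrr /=; apply: eq_bigr => s _.
by rewrite intrM -mulrA set_cons -setDDl.
Qed.

(** The expansion of a determinant along row and column [v], with one Schur
    complement term for each colour. *)
Lemma heap_sum_step J U v x : v \in U ->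
  heap_sum J U x = x v * heap_sum J (U :\ v) x -
    \sum_(j in J) path_sum (fun W => heap_sum J W x) (A j) U v v.
Proof.
move=> vU; rewrite (heap_sum_split _ _ vU); congr (_ - _).
apply: eq_bigr => j _.
rewrite (sum_cycles (fun g => (cycle_weight A (g, j))%:~R *
  heap_sum J (U :\: arcs_vertices g) x) vU).
rewrite /path_sum big_seq [RHS]big_seq; apply: eq_bigr => s.
rewrite mem_self_avoiding => /andP[us /allP sU].
have vs : v \notin s by apply/negP => /sU; rewrite !inE eqxx.
by rewrite /cycle_weight /= prod_cyc /= ?vs // arcs_vertices_cyc set_cons -setDDl.
Qed.

End Sums.

Lemma card_cycle_vertices y : is_cycle y.1 -> #|cycle_vertices y| = cycle_length y.
Proof.
case/existsP=> t /existsP[s /andP[us /eqP yE]].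
by rewrite /cycle_vertices /cycle_length yE card_in_imset // => _ _
  /imsetP[a _ ->] /imsetP[b _ ->] /= ->.
Qed.

(** A cycle has as many vertices as arcs, and the cycles of a heap are disjoint. *)
Lemma card_heap_vertices M : trivial_heap A M -> #|heap_vertices M| = heap_length M.
Proof.
case/trivial_heapP=> H1 H2; rewrite /heap_length.
pose F y := if y \in M then cycle_vertices y else set0.
have -> : heap_vertices M = \bigcup_y F y by rewrite /heap_vertices big_mkcond.
rewrite -sum1_card partition_disjoint_bigcup => [|y z yz]; last first.
  rewrite /F; case: ifP => yM; last by rewrite -setI_eq0 set0I.
  by case: ifP => zM; [exact: H2 | rewrite -setI_eq0 setI0].
rewrite [RHS]big_mkcond; apply: eq_bigr => y _; rewrite sum1_card /F.
case: ifP => yM; last by rewrite cards0.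
by rewrite card_cycle_vertices //; case/andP: (H1 y yM).
Qed.

Lemma horner_additive_char_poly (K : comNzRingType) (z : K) :
  (map_poly intr (additive_char_poly A)).[z] = heap_sum setT setT (fun=> z).
Proof.
rewrite /additive_char_poly rmorph_sum /= horner_sum /heap_sum.
pose len M : 'I_n.+1 := inord (heap_length M).
have lenE M : trivial_heap A M -> len M = heap_length M :> nat.
  move=> HM; rewrite /len inordK // ltnS -card_heap_vertices //.
  by rewrite -[n in (_ <= n)%N]card_ord max_card.
rewrite (partition_big len predT) //=; apply: eq_bigr => k _.
rewrite map_polyZ map_polyXn hornerZ hornerXn /additive_char_coef rmorph_sum.
rewrite big_distrl; apply: eq_big => [M|M /andP[HM /eqP lenM]] /=.
  rewrite /heap_in subsetT andbT -andbA.
  have -> : [forall y in M, y.2 \in [set: 'I_c]].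
    by apply/forall_inP => y _; rewrite inE.
  rewrite andTb; apply: andb_id2l => HM; by rewrite -val_eqE /= lenE.
rewrite /heap_term rmorphM rmorphXn rmorphN1; congr (_ * _).
rewrite prodr_const; congr (_ ^+ _).
by rewrite setTD cardsCs setCK card_ord -lenM card_heap_vertices.
Qed.

End Heaps.

(** * One colour: the heap sum has no zero in a product of upper half-planes *)

Section UpperHalfPlane.
Variables (R : rcfType) (n : nat) (B : 'M[int]_n) (x : 'I_n -> R[i]).
Hypothesis B_sym : forall u v, B u v = B v u.
Hypothesis x_gt0 : forall v, 0 < complex.Im (x v).
Implicit Types (U : {set 'I_n}) (u v w : 'I_n) (t : 'I_n -> R[i]).

Let sqn (z : R[i]) : R := complex.Re z ^+ 2 + complex.Im z ^+ 2.

Let Im_conjM (z y : R[i]) :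
  complex.Im (conjc z * y) = complex.Re z * complex.Im y - complex.Im z * complex.Re y.
Proof. by case: z y => [a b] [d e]; rewrite /=; ring. Qed.

Let Im_conjMM (z y : R[i]) : complex.Im (conjc z * (y * z)) = complex.Im y * sqn z.
Proof. by case: z y => [a b] [d e]; rewrite /sqn /=; ring. Qed.

Let Im_intM (k : int) (y : R[i]) : complex.Im (k%:~R * y) = k%:~R * complex.Im y.
Proof.
have -> : k%:~R = (k%:~R)%:C :> R[i] by rewrite rmorph_int.
by case: y => a b /=; ring.
Qed.

Let Re_intM (k : int) (y : R[i]) : complex.Re (k%:~R * y) = k%:~R * complex.Re y.
Proof.
have -> : k%:~R = (k%:~R)%:C :> R[i] by rewrite rmorph_int.
by case: y => a b /=; ring.
Qed.

(** The system [(diag(x) - B) t = b] restricted to the coordinates in [U]. *)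
Definition resolves U (b t : 'I_n -> R[i]) :=
  forall u, u \in U -> x u * t u - \sum_(w in U) (B u w)%:~R * t w = b u.

(** Pair the system with the conjugate of [t]: the quadratic form of the real
    symmetric matrix [B] takes real values, so only the diagonal contributes. *)
Lemma resolves_energy U b t : resolves U b t ->
  complex.Im (\sum_(w in U) conjc (t w) * b w) =
  \sum_(w in U) complex.Im (x w) * sqn (t w).
Proof.
move=> tP; rewrite (raddf_sum (@complex.Im R)).
under eq_bigr => w wU do rewrite -tP // mulrBr raddfB /= Im_conjMM.
rewrite sumrB -[RHS]subr0; congr (_ - _).
set S := LHS.
have SE : S = \sum_(w in U) \sum_(w' in U) (B w w')%:~R *
    (complex.Re (t w) * complex.Im (t w') - complex.Im (t w) * complex.Re (t w')).
  apply: eq_bigr => w _; rewrite big_distrr /= (raddf_sum (@complex.Im R)).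
  by apply: eq_bigr => w' _ /=; rewrite Im_conjM Im_intM Re_intM; ring.
suff : S = - S by move=> E; lra.
rewrite {1}SE exchange_big SE -sumrN; apply: eq_bigr => w _.
by rewrite -sumrN; apply: eq_bigr => w' _; rewrite B_sym; ring.
Qed.

Let sqn_ge0 z : 0 <= sqn z.
Proof. by rewrite /sqn addr_ge0 // sqr_ge0. Qed.

(** A solution of the homogeneous system has zero energy. *)
Lemma resolves_unique U b t t' : resolves U b t -> resolves U b t' ->
  {in U, t =1 t'}.
Proof.
move=> tP t'P; pose d w := t w - t' w.
have dP : resolves U (fun=> 0) d.
  move=> u uU; rewrite /d; under eq_bigr do rewrite mulrBr.
  rewrite sumrB; apply: (etrans _ (subrr (b u))).
  by rewrite -{1}(tP u uU) -(t'P u uU); ring.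
have := resolves_energy dP; rewrite big1 => [E u uU|w _]; last by rewrite mulr0.
have /eqP := esym E; rewrite psumr_eq0 => [/allP/(_ u)|w _]; last first.
  by rewrite mulr_ge0 // ltW.
rewrite mem_index_enum uU mulf_eq0 gt_eqF //= => /(_ isT) /eqP d0.
apply/eqP; rewrite -subr_eq0 -[_ - _]/(d u); move: d0; rewrite /sqn.
case: (d u) => a b' /=; move/eqP; rewrite paddr_eq0 ?sqr_ge0 // !sqrf_eq0.
by case/andP=> /eqP -> /eqP ->.
Qed.

(** As [b] is real here, the sum is the conjugate of the one in the energy
    identity, hence the sign. *)
Lemma resolves_Im_le0 U v t : resolves U (fun u => (B u v)%:~R) t ->
  complex.Im (\sum_(w in U) (B v w)%:~R * t w) <= 0.
Proof.
move=> /resolves_energy E.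
have -> : complex.Im (\sum_(w in U) (B v w)%:~R * t w) =
          - complex.Im (\sum_(w in U) conjc (t w) * (B w v)%:~R).
  rewrite !(raddf_sum (@complex.Im R)) -sumrN; apply: eq_bigr => w _.
  by rewrite /= [conjc _ * _]mulrC !Im_intM B_sym; case: (t w) => a b /=; ring.
by rewrite E oppr_le0 sumr_ge0 // => w _; rewrite mulr_ge0 // ltW.
Qed.

Variable H : {set 'I_n} -> R[i].
Hypothesis H_set0 : H set0 != 0.
Hypothesis H_step : forall U v, v \in U ->
  H U = x v * H (U :\ v) - path_sum H B U v v.

Let T U v u := path_sum H B U u v / H U.

(** Induction on [U]. If path sums solve the system on [U :\ u] with right-hand
    side column [u], then [H U / H (U :\ u)] is [x u] minus a sum with
    nonpositive imaginary part, up to a real number. *)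
Lemma path_sum_resolves U :
  H U != 0 /\ forall v, resolves U (fun u => (B u v)%:~R) (T U v).
Proof.
have [m] := ubnP #|U|; elim: m U => // m IHm U leUm.
have [->|[u0 u0U]] := set_0Vmem U.
  by split=> // v u; rewrite inE.
have IH u : u \in U -> H (U :\ u) != 0 /\
    forall v, resolves (U :\ u) (fun w => (B w v)%:~R) (T (U :\ u) v).
  by move=> uU; apply: IHm; move: leUm; rewrite (cardsD1 u) uU add1n ltnS.
have pathE u v : u \in U -> path_sum H B U u v = H (U :\ u) *
    ((B u v)%:~R + \sum_(w in U :\ u) (B u w)%:~R * T (U :\ u) v w).
  move=> uU; have [Hu _] := IH u uU; rewrite path_sum_step mulrDr mulrC.
  congr (_ + _); rewrite big_distrr; apply: eq_bigr => w _ /=.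
  by rewrite /T [RHS]mulrCA (mulrC (H _)) divfK.
have HE u : u \in U -> H U = H (U :\ u) * (x u - (B u u)%:~R -
    \sum_(w in U :\ u) (B u w)%:~R * T (U :\ u) u w).
  by move=> uU; rewrite (H_step uU) pathE // !mulrBr mulrC mulrDr opprD addrA.
have HU : H U != 0.
  have [Hu solv] := IH u0 u0U; rewrite (HE u0 u0U) mulf_neq0 //.
  have Bu : complex.Im ((B u0 u0)%:~R : R[i]) = 0.
    by rewrite -[_%:~R]mulr1 Im_intM mulr0.
  apply/negP => /eqP/(congr1 (@complex.Im R)); rewrite !raddfB /= Bu => E.
  have := resolves_Im_le0 (solv u0); have := x_gt0 u0; lra.
split=> // v.
(* Eliminating all coordinates but [u] first yields, for each [u], a solution
   [t u] whose value at [u] is the path sum. By uniqueness these solutions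
   coincide, so the vector of path sums is one of them. *)
pose t u w := if w == u then T U v u else
  T (U :\ u) v w + T (U :\ u) u w * T U v u.
have tP u : u \in U -> resolves U (fun w => (B w v)%:~R) (t u).
  move=> uU w wU; have [Hu solv] := IH u uU.
  rewrite (big_setD1 u) //= {2}/t eqxx.
  have sumE : \sum_(a in U :\ u) (B w a)%:~R * t u a =
      \sum_(a in U :\ u) (B w a)%:~R * T (U :\ u) v a +
      (\sum_(a in U :\ u) (B w a)%:~R * T (U :\ u) u a) * T U v u.
    rewrite big_distrl -big_split; apply: eq_bigr => a /setD1P[au _] /=.
    by rewrite /t (negbTE au); ring.
  rewrite sumE; have [->|wu] := eqVneq w u.
    rewrite /t eqxx; have : (x u - (B u u)%:~R -
        \sum_(a in U :\ u) (B u a)%:~R * T (U :\ u) u a) * T U v u =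
        (B u v)%:~R + \sum_(a in U :\ u) (B u a)%:~R * T (U :\ u) v a.
      move: HU; rewrite {2}/T pathE // (HE u uU) mulf_eq0 negb_or => /andP[_ D0].
      by rewrite -mulf_div divff // mul1r mulrC divfK.
    move: (\sum_(i in _) _) (\sum_(i in _) _) => S1 S2 E.
    by rewrite -[RHS](addrK S1) -E; ring.
  have wU' : w \in U :\ u by rewrite !inE wu.
  rewrite /t (negbTE wu) -(solv v w wU').
  have := solv u w wU'; move: (\sum_(i in _) _) => S E.
  by rewrite -E; ring.
move=> u uU.
have tT w : w \in U -> T U v w = t u w.
  by move=> wU; rewrite -(resolves_unique (tP w wU) (tP u uU) wU) /t eqxx.
rewrite tT // -(tP u uU u uU); congr (_ - _).
by apply: eq_bigr => w wU; rewrite tT.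
Qed.

End UpperHalfPlane.

(** * Merging colours preserves the absence of zeros *)

Section MultiAffine.
Variables (K : comNzRingType) (n : nat).
Implicit Types (p q : {set 'I_n} -> K) (x : 'I_n -> K) (U V W S : {set 'I_n}).

(** Coefficients are indexed by the complement of the monomial, since a heap
    contributes the variables of the vertices that it does not cover. *)
Definition multi_affine U p x : K :=
  \sum_(W : {set 'I_n} | W \subset U) p W * \prod_(v in U :\: W) x v.

Definition convolution p q W : K := \sum_(S : {set 'I_n} | S \subset W) p S * q (W :\: S).

Lemma sum_subset_setU1 (F : {set 'I_n} -> K) v U : v \notin U ->
  \sum_(W : {set 'I_n} | W \subset v |: U) F W =
  \sum_(W : {set 'I_n} | W \subset U) F W + \sum_(W : {set 'I_n} | W \subset U) F (v |: W).
Proof.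
move=> vU; rewrite (bigID (fun W => v \in W)) /= addrC; congr (_ + _).
  apply: eq_bigl => W; rewrite -[U in RHS](setU1K vU) subsetD1.
  by [].
rewrite (reindex_onto (fun W => v |: W) (fun W => W :\ v)) /=; last first.
  by move=> W /andP[_ vW]; rewrite setD1K.
apply: eq_bigl => W; rewrite setU11 andbT.
apply/andP/idP => [[sWU /eqP EW]|sWU].
  have vW : v \notin W by rewrite -EW setD11.
  by rewrite -(setU1K vU) -(setU1K vW) setSD.
by rewrite setUS // setU1K // (contra (subsetP sWU v)).
Qed.

Lemma multi_affine_setU1 v U p x : v \notin U ->
  multi_affine (v |: U) p x =
  x v * multi_affine U p x + multi_affine U (fun W => p (v |: W)) x.
Proof.
move=> vU; rewrite /multi_affine sum_subset_setU1 // big_distrr.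
congr (_ + _); apply: eq_bigr => W sWU /=.
  have vW : v \notin W by apply: contra (subsetP sWU v) vU.
  rewrite (big_setD1 v) ?inE ?vW ?eqxx //= mulrCA; congr (_ * (_ * _)).
  by rewrite setDDl [W :|: _]setUC -setDDl setU1K.
congr (_ * _); apply: eq_bigl => w; rewrite !inE negb_or.
by have [->|] := eqVneq w v; rewrite //= (negbTE vU) andbF.
Qed.

Lemma convolution_setU1 v p q W : v \notin W ->
  convolution p q (v |: W) =
  convolution p (fun S => q (v |: S)) W + convolution (fun S => p (v |: S)) q W.
Proof.
move=> vW; rewrite /convolution sum_subset_setU1 //; congr (_ + _).
  apply: eq_bigr => S sSW; congr (_ * q _).
  apply/setP => w; rewrite !inE; have [->|//] := eqVneq w v.
  by rewrite (contra (subsetP sSW v)).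
apply: eq_bigr => S sSW; congr (_ * q _); apply/setP => w; rewrite !inE negb_or.
by have [->|] := eqVneq w v; rewrite //= (negbTE vW) andbF.
Qed.

Lemma eq_multi_affine U p q x y :
  (forall W, W \subset U -> p W = q W) -> {in U, x =1 y} ->
  multi_affine U p x = multi_affine U q y.
Proof.
move=> eq_pq eq_xy; apply: eq_bigr => W sWU; rewrite eq_pq //; congr (_ * _).
by apply: eq_bigr => v /setDP[vU _]; apply: eq_xy.
Qed.

Lemma multi_affineD U p q x :
  multi_affine U (fun W => p W + q W) x =
  multi_affine U p x + multi_affine U q x.
Proof. by rewrite -big_split; apply: eq_bigr => W _; rewrite /= mulrDl. Qed.

Lemma multi_affineZ U a p x :
  multi_affine U (fun W => a * p W) x = a * multi_affine U p x.
Proof. by rewrite big_distrr; apply: eq_bigr => W _; rewrite /= mulrA. Qed.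

(** With the variable of [v] frozen at [a] in one factor and at [b] in the other,
    merging the remaining vertices gives a polynomial that is affine in [a] and
    in [b]; [convolution_setU1] merges these two variables. *)
Lemma multi_affine_convolution_shift v U a b p q x :
  multi_affine U (convolution (fun W => a * p W + p (v |: W))
                              (fun W => b * q W + q (v |: W))) x =
  a * b * multi_affine U (convolution p q) x +
  a * multi_affine U (convolution p (fun W => q (v |: W))) x +
  b * multi_affine U (convolution (fun W => p (v |: W)) q) x +
  multi_affine U (convolution (fun W => p (v |: W)) (fun W => q (v |: W))) x.
Proof.
rewrite -!multi_affineZ -!multi_affineD.
apply: eq_multi_affine => // W _; rewrite /convolution !big_distrr -!big_split.
by apply: eq_bigr => S _ /=; ring.
Qed.

End MultiAffine.

Section Stability.
Variables (R : rcfType) (n : nat).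
Implicit Types (p q : {set 'I_n} -> R[i]) (U : {set 'I_n}).

(** All the polynomials in fewer variables are included: they are the leading
    coefficients in the remaining variables, and the merging of two variables
    needs a nonzero leading coefficient. *)
Definition stable U p := forall (V : {set 'I_n}) (x : 'I_n -> R[i]), V \subset U ->
  (forall v, 0 < complex.Im (x v)) -> multi_affine V p x != 0.

(** The zeros in [y] of the diagonal [a * y * y + (b + c) * y + d] lie in the
    closed lower half-plane, hence so does their sum [- (b + c) / a]. *)
Lemma merge_variables (a b c d x : R[i]) : a != 0 ->
    (forall y z, 0 < complex.Im y -> 0 < complex.Im z ->
       y * z * a + y * b + z * c + d != 0) ->
  0 < complex.Im x -> x * a + (b + c) != 0.
Proof.
move=> a0 abcd x_gt0; apply/negP => /eqP xE.
(* The diagonal is [a] times [(y - x / 2) ^+ 2 - s ^+ 2]; the zero [y] chosen below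
   has imaginary part at least that of [x / 2]. *)
pose s : R[i] := sqrtC ((x / 2) ^+ 2 - d / a).
have Im2 : complex.Im (x / 2) = complex.Im x / 2.
  have -> : (2^-1 : R[i]) = (2^-1)%:C by rewrite fmorphV rmorph_nat.
  by case: (x) => r t /=; ring.
have [y [y_gt0 yE]] : exists y, 0 < complex.Im y /\ (y - x / 2) ^+ 2 = s ^+ 2.
  have [s_ge0|s_lt0] := leP 0 (complex.Im s).
    by exists (x / 2 + s); rewrite addrAC subrr add0r raddfD /= Im2; split=> //; lra.
  exists (x / 2 - s); rewrite addrAC subrr add0r sqrrN raddfB /= Im2; split=> //.
  by lra.
have /eqP := abcd y y y_gt0 y_gt0; apply.
rewrite sqrtCK in yE.
have dE : d = a * ((x / 2) ^+ 2 - (y - x / 2) ^+ 2) by rewrite yE; field.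
have bE : b = - x * a - c by rewrite -[RHS]addr0 -xE; ring.
by rewrite dE bE; field.
Qed.

Lemma stable_shift v U p y : v \notin U -> stable (v |: U) p ->
  0 < complex.Im y -> stable U (fun W => y * p W + p (v |: W)).
Proof.
move=> vU stab_p y_gt0 V x sVU x_gt0.
have vV : v \notin V by apply: contra (subsetP sVU v) vU.
pose x' w := if w == v then y else x w.
have : multi_affine (v |: V) p x' != 0.
  by apply: stab_p => [|w]; [exact: setUS | rewrite /x'; case: eqP].
rewrite multi_affine_setU1 // multi_affineD multi_affineZ {1}/x' eqxx.
have E q : multi_affine V q x' = multi_affine V q x.
  apply: eq_multi_affine => // w wV; rewrite /x'; case: eqP => // wv.
  by rewrite -wv wV in vV.
by rewrite !E.
Qed.

(** Induction on [U]: freeze the two variables [y] and [z] of a vertex [v] in the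
    upper half-plane, merge the other vertices first by induction, and merge the
    two variables of [v] last. *)
Lemma stable_convolution U p q :
  stable U p -> stable U q -> stable U (convolution p q).
Proof.
move=> stab_p stab_q V x sVU x_gt0.
have {stab_p} : stable V p by move=> W y sWV; apply/stab_p/(subset_trans sWV).
have {stab_q} : stable V q by move=> W y sWV; apply/stab_q/(subset_trans sWV).
have [m] := ubnP #|V|; elim: m V p q {U sVU} => // m IHm V p q leVm stab_q stab_p.
have [V0|[v vV]] := set_0Vmem V.
  have conv0 : multi_affine V (convolution p q) x =
      multi_affine V p x * multi_affine V q x.
    rewrite /multi_affine V0 !(big_pred1 set0) => [|W|W|W]; rewrite ?subset0 //.
    rewrite /convolution (big_pred1 set0) => [|W]; rewrite ?subset0 //.
    by rewrite setD0 big_set0 !mulr1.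
  by rewrite conv0 mulf_neq0 ?stab_p ?stab_q.
rewrite -(setD1K vV) in stab_p stab_q *; move: stab_p stab_q.
have : v \notin V :\ v by rewrite setD11.
have : (#|V :\ v| < m)%N by rewrite (cardsD1 v) vV in leVm.
move: (V :\ v) => U leUm vU stab_p stab_q.
have stabU r : stable (v |: U) r -> stable U r.
  by move=> stab_r W y sWU; apply/stab_r/(subset_trans sWU)/subsetUr.
rewrite multi_affine_setU1 //.
rewrite (@eq_multi_affine _ _ U (fun W => convolution p q (v |: W))
  (fun W => convolution p (fun S => q (v |: S)) W +
  convolution (fun S => p (v |: S)) q W) x x) // => [|W sWU]; last first.
  by rewrite [LHS]convolution_setU1 // (contra (subsetP sWU v)).
rewrite multi_affineD.
apply: (@merge_variables _ _ _ (multi_affine U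
  (convolution (fun W => p (v |: W)) (fun W => q (v |: W))) x)) => //.
  by apply: IHm => //; apply: stabU.
move=> y z y_gt0 z_gt0; rewrite -multi_affine_convolution_shift.
by apply: IHm => //; apply: stable_shift.
Qed.

End Stability.

Section HeapStability.
Variables (c n : nat) (A : 'I_c -> 'M[int]_n).
Implicit Types (M : {set colored_cycle c n}) (U W S : {set 'I_n}).
Implicit Types (J : {set 'I_c}) (v : 'I_n) (y : colored_cycle c n).

Section Coefficients.
Variable K : comNzRingType.

Definition heap_coef J W : K :=
  \sum_(M | heap_in A J W M && (heap_vertices M == W)) heap_term A K M.

Lemma heap_sumE J U (x : 'I_n -> K) :
  heap_sum A J U x = multi_affine U (heap_coef J) x.
Proof.
rewrite /heap_sum (partition_big (@heap_vertices c n) (fun W => W \subset U)) /=.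
  apply: eq_bigr => W sWU; rewrite /heap_coef big_distrl.
  apply: eq_big => [M|M /andP[_ /eqP ->]] //.
  rewrite /heap_in; have [->|] := eqVneq; last by rewrite !andbF.
  by rewrite sWU subxx !andbT.
by move=> M /and3P[].
Qed.

Lemma cycle_vertices_neq0 y : is_cycle y.1 -> cycle_vertices y != set0.
Proof.
move=> cy; rewrite -card_gt0 card_cycle_vertices //; case/existsP: cy => t.
case/existsP=> s /andP[us /eqP yE].
by rewrite /cycle_length yE card_imset ?(card_uniqP us) ?size_tuple // => a b [].
Qed.

Lemma heap_sum_set0 J (x : 'I_n -> K) : heap_sum A J set0 x = 1.
Proof.
rewrite /heap_sum (big_pred1 set0) => [|M].
  by rewrite /heap_term /heap_weight cards0 set0D !big_set0 expr0 !mulr1.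
apply/and3P/eqP => [[/trivial_heapP[H _] _ M0]|->].
  apply/setP => y; rewrite inE; apply/negbTE/negP => yM.
  have /andP[/cycle_vertices_neq0/negP y0 _] := H y yM; apply: y0.
  by rewrite -subset0 (subset_trans (heap_vertices_sub yM)).
split; last by rewrite /heap_vertices big_set0.
  by apply/trivial_heapP; split=> [y|y z]; rewrite inE.
by apply/forall_inP => y; rewrite inE.
Qed.

Lemma heap_sum_no_colour U (x : 'I_n -> K) :
  heap_sum A set0 U x = \prod_(v in U) x v.
Proof.
rewrite /heap_sum (big_pred1 set0) => [|M].
  rewrite /heap_term /heap_weight cards0 /heap_vertices !big_set0 setD0.
  by rewrite expr0 !mul1r.
apply/and3P/eqP => [[_ /forall_inP H _]|->].
  by apply/setP => y; rewrite inE; apply/negbTE/negP => /H; rewrite inE.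
split; last by rewrite /heap_vertices big_set0 sub0set.
  by apply/trivial_heapP; split=> [y|y z]; rewrite inE.
by apply/forall_inP => y; rewrite inE.
Qed.

(** A heap with colours in [j |: J] is a heap of colour [j] and a heap with
    colours in [J] that cover complementary parts of its vertices. *)
Lemma heap_in_setU j J W S M1 M2 : j \notin J -> S \subset W ->
    M1 \subset [set y | y.2 == j] -> [disjoint M2 & [set y | y.2 == j]] ->
  [&& heap_in A (j |: J) W (M1 :|: M2), heap_vertices (M1 :|: M2) == W
    & heap_vertices M1 == S] =
  (heap_in A [set j] S M1 && (heap_vertices M1 == S)) &&
  (heap_in A J (W :\: S) M2 && (heap_vertices M2 == W :\: S)).
Proof.
move=> jJ sSW M1j M2j.
have hvU : heap_vertices (M1 :|: M2) = heap_vertices M1 :|: heap_vertices M2.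
  exact: bigcup_setU.
have M12 y z : y \in M1 -> z \in M2 -> y != z.
  move=> yM1 zM2; apply: contraTneq (subsetP M1j y yM1) => ->.
  by rewrite (disjointFr M2j zM2).
apply/and3P/andP.
  case=> /and3P[/trivial_heapP[H1 H2] /forall_inP HJ _] /eqP hW /eqP hS.
  have dis : [disjoint heap_vertices M1 & heap_vertices M2].
    apply/bigcup_disjointP => z zM2; rewrite disjoint_sym.
    apply/bigcup_disjointP => y yM1; rewrite disjoint_sym.
    by apply: H2; rewrite ?inE ?yM1 ?zM2 ?orbT // M12.
  have hM2 : heap_vertices M2 = W :\: S.
    rewrite -hW -hS hvU setDUl setDv set0U.
    by apply/esym/setDidPl; rewrite disjoint_sym.
  split; apply/andP; split; rewrite ?hM2 ?hS //; apply/and3P; split;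
    rewrite ?hM2 ?hS //.
  - apply/trivial_heapP; split=> [y yM|y z yM zM].
      by apply: H1; rewrite inE yM.
    by apply: H2; rewrite inE ?yM ?zM.
  - by apply/forall_inP => y /(subsetP M1j); rewrite !inE.
  - apply/trivial_heapP; split=> [y yM|y z yM zM].
      by apply: H1; rewrite inE yM orbT.
    by apply: H2; rewrite inE ?yM ?zM orbT.
  - apply/forall_inP => y yM; have := HJ y; rewrite !inE yM orbT => /(_ isT).
    by have := disjointFr M2j yM; rewrite inE => ->.
case=> /andP[/and3P[/trivial_heapP[H1 H2] /forall_inP HJ _] /eqP hS].
case/andP=> /and3P[/trivial_heapP[H1' H2'] /forall_inP HJ' _] /eqP hWS.
have hW : heap_vertices (M1 :|: M2) = W.
  by rewrite hvU hS hWS -{1}(setIidPr sSW) setID.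
split; rewrite ?hW ?hS //; apply/and3P; split; rewrite ?hW //.
- have dis y z : y \in M1 -> z \in M2 ->
      [disjoint cycle_vertices y & cycle_vertices z].
    move=> yM1 zM2; apply: disjointWl (heap_vertices_sub yM1) _.
    apply: disjointWr (heap_vertices_sub zM2) _.
    by rewrite hS hWS -setI_eq0 setIDA setDIl setDv set0I.
  apply/trivial_heapP; split=> [y /setUP[/H1|/H1']//|y z].
  move=> /setUP[yM|yM] /setUP[zM|zM]; [exact: H2| | |exact: H2'] => _.
    exact: dis.
  by rewrite disjoint_sym dis.
- apply/forall_inP => y /setUP[/HJ|/HJ']; rewrite !inE; first by move->.
  by move->; rewrite orbT.
Qed.

Lemma heap_term_setU M1 M2 : [disjoint M1 & M2] ->
  heap_term A K (M1 :|: M2) = heap_term A K M1 * heap_term A K M2.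
Proof.
move=> dis; rewrite /heap_term /heap_weight cardsU disjoint_setI0 // cards0 subn0.
rewrite (eq_bigl (predU (mem M1) (mem M2))) => [|y]; last by rewrite !inE.
by rewrite bigU //= intrM exprD mulrACA.
Qed.

Lemma heap_coef_setU1 j J W : j \notin J ->
  heap_coef (j |: J) W = convolution (heap_coef [set j]) (heap_coef J) W.
Proof.
move=> jJ; rewrite /convolution /heap_coef.
pose C := [set y : colored_cycle c n | y.2 == j].
rewrite (partition_big (fun M => heap_vertices (M :&: C))
  (fun S => S \subset W)) /=; last first.
  move=> M /andP[_ /eqP <-]; apply/bigcupsP => y /setIP[yM _].
  exact: heap_vertices_sub.
apply: eq_bigr => S sSW; rewrite big_distrlr pair_big /=.
rewrite (reindex_onto (fun p => p.1 :|: p.2) (fun M => (M :&: C, M :\: C))) /=; last first.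
  by move=> M _; rewrite setID.
have splitE (M1 M2 : {set colored_cycle c n}) :
  (((M1 :|: M2) :&: C, (M1 :|: M2) :\: C) == (M1, M2)) =
  (M1 \subset C) && [disjoint M2 & C].
  rewrite xpair_eqE; apply/andP/andP => [[/eqP E1 /eqP E2]|[M1C M2C]].
    rewrite -E1 subsetIr; split=> //.
    by rewrite -E2 -setI_eq0 setDE -setIA [~: C :&: _]setIC setICr setI0.
  rewrite setIUl setDUl (setIidPl M1C) (disjoint_setI0 M2C) setU0 eqxx.
  by rewrite (setDidPl M2C); move: M1C; rewrite -setD_eq0 => /eqP ->; rewrite set0U.
have disC (M1 M2 : {set colored_cycle c n}) :
    M1 \subset C -> [disjoint M2 & C] -> [disjoint M1 & M2].
  by move=> M1C M2C; apply: disjointWl M1C _; rewrite disjoint_sym.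
apply: eq_big => [[M1 M2]|[M1 M2] /andP[_]] /=; last first.
  by rewrite splitE => /andP[M1C M2C]; rewrite heap_term_setU // disC.
rewrite splitE; apply/idP/idP.
  case/andP=> + /andP[M1C M2C]; rewrite -andbA.
  have -> : (M1 :|: M2) :&: C = M1.
    by rewrite setIUl (setIidPl M1C) (disjoint_setI0 M2C) setU0.
  by rewrite heap_in_setU.
move=> H; have [M1C M2C] : M1 \subset C /\ [disjoint M2 & C].
  case/andP: H => /andP[/and3P[_ /forall_inP H1 _] _] /andP[/and3P[_ /forall_inP H2 _] _].
  split; first by apply/subsetP => y /H1; rewrite !inE.
  rewrite disjoints_subset; apply/subsetP => y /H2; rewrite !inE.
  by apply: contraTneq => ->.
rewrite M1C M2C andbT; move: H; rewrite -(heap_in_setU jJ sSW M1C M2C).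
have -> : (M1 :|: M2) :&: C = M1.
  by rewrite setIUl (setIidPl M1C) (disjoint_setI0 M2C) setU0.
by case/and3P=> -> -> ->.
Qed.

End Coefficients.

Lemma heap_coef_stable (R : rcfType) J : (forall j u v, A j u v = A j v u) ->
  stable setT (@heap_coef R[i] J).
Proof.
move=> A_sym; have [m] := ubnP #|J|; elim: m J => // m IHm J leJm.
have [->|[j jJ]] := set_0Vmem J.
  move=> V x _ x_gt0; rewrite -heap_sumE heap_sum_no_colour.
  apply/prodf_neq0 => v _; have := x_gt0 v; apply: contraTneq => ->.
  by rewrite ltxx.
have jJ' : j \notin J :\ j by rewrite setD11.
have stab_j : stable setT (@heap_coef R[i] [set j]).
  move=> V x _ x_gt0; rewrite -heap_sumE.
  have [] // := @path_sum_resolves R n (A j) x (A_sym j) x_gt0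
    (fun W => heap_sum A [set j] W x) _ _ V.
    by rewrite heap_sum_set0 oner_neq0.
  by move=> U v vU; rewrite {1}(heap_sum_step _ _ _ vU) big_set1.
have stab_J : stable setT (@heap_coef R[i] (J :\ j)).
  by apply: IHm; move: leJm; rewrite (cardsD1 j) jJ.
rewrite -(setD1K jJ) => V x sV x_gt0.
rewrite (@eq_multi_affine _ _ _ _ (convolution (heap_coef _ [set j])
  (heap_coef _ (J :\ j))) x x) => [|W _|//]; last exact: heap_coef_setU1.
exact: (stable_convolution stab_j stab_J sV x_gt0).
Qed.

(** Conjugation exchanges the two half-planes and fixes the polynomial. *)
Lemma additive_char_poly_real_rooted (R : rcfType) (z : R[i]) :
    (forall j u v, A j u v = A j v u) ->
  root (map_poly intr (additive_char_poly A)) z -> complex.Im z = 0.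
Proof.
move=> A_sym; set p := map_poly _ _.
have no_root (y : R[i]) : 0 < complex.Im y -> root p y -> False.
  move=> y_gt0 /rootP; rewrite horner_additive_char_poly heap_sumE.
  by apply/eqP; apply: (heap_coef_stable _ _).
have conjp : map_poly (@conjc R) p = p.
  by apply/polyP => k; rewrite !coef_map /= rmorph_int.
move=> rz; have [z_lt0|/no_root/(_ rz)//|//] := ltgtP (complex.Im z) 0.
have /no_root[] : 0 < complex.Im (conjc z) by case: (z) z_lt0 => a b /=; lra.
by rewrite -conjp fmorph_root.
Qed.

End HeapStability.

(** * Heap sums bounded by a positive supersolution *)

Section Supersolution.
Variables (R : realFieldType) (c n : nat) (A : 'I_c -> 'M[int]_n).
Hypothesis A_sym : forall j u v, A j u v = A j v u.
Hypothesis A_ge0 : forall j u v, 0 <= A j u v.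
Hypothesis A_diag : forall j u, A j u u = 0.
Let N j := nonisolated (A j).

(** [T] stands for the vertices of the additive product: [last_vertex] projects
    them to the base vertices, and [move_to y j w] is the vertex above [w] in the
    unique copy of [A j] that contains [y]. No vertex serves as a root: the
    argument is the same in all copies. *)
Variables (T : Type) (last_vertex : T -> 'I_n) (move_to : T -> 'I_c -> 'I_n -> T).
Hypothesis last_move : forall y j w, last_vertex y \in N j -> w \in N j ->
  last_vertex (move_to y j w) = w.
Hypothesis move_move : forall y j w w', last_vertex y \in N j -> w \in N j ->
  w' \in N j -> move_to (move_to y j w) j w' = move_to y j w'.
Hypothesis move_last : forall y j, last_vertex y \in N j ->
  move_to y j (last_vertex y) = y.
Hypothesis last_onto : forall u, exists y, last_vertex y = u.

Variables (F : T -> R) (r z : R).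
Hypothesis F_gt0 : forall y, 0 < F y.
Hypothesis F_super : forall y,
  \sum_j \sum_w (A j (last_vertex y) w)%:~R * F (move_to y j w) <= r * F y.
Hypothesis r_lt : r < `|z|.

Variable H : {set 'I_n} -> R.
Hypothesis H_set0 : H set0 != 0.
Hypothesis H_step : forall (U : {set 'I_n}) v, v \in U ->
  H U = z * H (U :\ v) - \sum_j path_sum H (A j) U v v.

Let a j u v : R := (A j u v)%:~R.

Let a_ge0 j u v : 0 <= a j u v.
Proof. by rewrite ler0z. Qed.

Let a_nonisolated j u v : (u \notin N j) || (v \notin N j) -> a j u v = 0.
Proof.
have isolated w w' : w \notin N j -> A j w w' = 0.
  rewrite inE => /existsPn/(_ w'); rewrite negbK A_sym; exact/eqP.
by rewrite /a; case/orP => [/isolated -> //|]; rewrite A_sym => /isolated ->.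
Qed.

(** The total weight of the paths that start at [y], follow its copy of [A j] and
    leave [U], each counted with [F] at its end. With one colour, [z = r] and [F]
    satisfying equality in [F_super], the ratio of the two sides is the
    probability that the random walk with steps [A j u v * F v / (r * F u)] exits
    [U]. *)
Let escape_bound (U : {set 'I_n}) := forall y j, last_vertex y \in U -> last_vertex y \in N j ->
  \sum_(v | (v \notin U) && (v \in N j))
    `|path_sum H (A j) U (last_vertex y) v| * F (move_to y j v) <= `|H U| * F y.

Section Step.
Variables (U : {set 'I_n}) (y : T).
Let u := last_vertex y.
Hypothesis uU : u \in U.
Let U' := U :\ u.
Hypothesis IH : escape_bound U'.

Let G j := (\sum_(w in U') a j u w * `|path_sum H (A j) U' w u|) * F y.
Let S j := \sum_w a j u w * F (move_to y j w).
Let out j := \sum_(v | (v \notin U) && (v \in N j))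
  `|path_sum H (A j) U u v| * F (move_to y j v).

Let IH_move j w : w \in U' -> u \in N j -> w \in N j ->
  \sum_(v | (v \notin U') && (v \in N j))
    `|path_sum H (A j) U' w v| * F (move_to y j v) <=
  `|H U'| * F (move_to y j w).
Proof.
move=> wU' uN wN; have := IH (y := move_to y j w) (j := j).
rewrite last_move // => /(_ wU' wN); apply: le_trans.
by apply: ler_sum => v /andP[_ vN]; rewrite move_move.
Qed.

Let split_out j w : w \in U' -> u \in N j ->
  \sum_(v | (v \notin U) && (v \in N j))
    `|path_sum H (A j) U' w v| * F (move_to y j v) +
  `|path_sum H (A j) U' w u| * F y =
  \sum_(v | (v \notin U') && (v \in N j))
    `|path_sum H (A j) U' w v| * F (move_to y j v).
Proof.
move=> wU' uN; rewrite [RHS](bigD1 u) /=; last by rewrite in_setD1 eqxx.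
have -> : move_to y j u = y by apply: move_last.
rewrite addrC; congr (_ + _); apply: eq_bigl => v; rewrite in_setD1.
by have [->|_] := eqVneq v u; rewrite ?uU ?andbF ?andbT.
Qed.

(** [out j] collects the paths in the copy of [A j] that leave [U], and [G j] those
    that come back to [u]. From the first vertex [w] after [u], both leave [U'],
    so that together they are controlled by [F] at [w]. *)
Let out_bound j : u \in N j -> out j + G j <= `|H U'| * S j.
Proof.
move=> uN; pose P v := (v \notin U) && (v \in N j).
have leout : out j <= \sum_(v | P v) (`|H U'| * (a j u v * F (move_to y j v)) +
   \sum_(w in U') a j u w * (`|path_sum H (A j) U' w v| * F (move_to y j v))).
  apply: ler_sum => v _; under [X in _ <= _ + X]eq_bigr do rewrite mulrA.
  rewrite -mulr_suml mulrA -mulrDl ler_wpM2r ?(ltW (F_gt0 _)) //.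
  rewrite path_sum_step; apply: le_trans (ler_normD _ _) _.
  apply: lerD; first by rewrite normrM mulrC (ger0_norm (a_ge0 j u v)).
  apply: le_trans (ler_norm_sum _ _ _) _; apply: ler_sum => w _.
  by rewrite normrM (ger0_norm (a_ge0 j u w)).
apply: (@le_trans _ _ (\sum_(v | P v) `|H U'| * (a j u v * F (move_to y j v)) +
   \sum_(w in U') a j u w * (`|H U'| * F (move_to y j w)))).
  apply: le_trans (lerD leout (lexx _)) _.
  rewrite big_split /= -addrA lerD2l /G mulr_suml exchange_big -big_split /=.
  apply: ler_sum => w wU'; rewrite -mulr_sumr -mulrA -mulrDr split_out //.
  have [wN|wN] := boolP (w \in N j); last by rewrite a_nonisolated ?wN ?orbT ?mul0r.
  by rewrite ler_wpM2l ?a_ge0 // IH_move.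
rewrite -mulr_sumr; under [X in _ + X]eq_bigr do rewrite mulrCA.
rewrite -mulr_sumr -mulrDr ler_wpM2l // /S [X in _ <= X](bigID (fun v => v \in U')) /=.
rewrite addrC; apply: lerD => //; rewrite big_mkcond [X in _ <= X]big_mkcond.
apply: ler_sum => v _; have t_ge0 : 0 <= a j u v * F (move_to y j v).
  by rewrite mulr_ge0 ?a_ge0 ?ltW.
rewrite /P !inE; case: (v \in U) => /=; last by rewrite andbF; case: ifP.
by case: ifP.
Qed.

Let G_bound j : G j <= `|H U'| * S j.
Proof.
have S_ge0 : 0 <= S j.
  by apply: sumr_ge0 => w _; rewrite mulr_ge0 ?a_ge0 ?ltW.
have [uN|uN] := boolP (u \in N j); last first.
  rewrite /G big1 ?mul0r ?mulr_ge0 // => w _.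
  by rewrite a_nonisolated ?uN ?mul0r.
apply: le_trans (out_bound uN); rewrite lerDr.
by apply: sumr_ge0 => v _; rewrite mulr_ge0 // ltW.
Qed.

(** The recursion at [u] for [H U], where the closed paths of every colour
    reappear as [G]. *)
Let H_bound : `|z| * `|H U'| * F y <= `|H U| * F y + \sum_j G j.
Proof.
rewrite -mulr_suml -mulrDl ler_wpM2r ?(ltW (F_gt0 y)) //.
rewrite -normrM.
have -> : z * H U' = H U + \sum_j \sum_(w in U') a j u w * path_sum H (A j) U' w u.
  rewrite (H_step uU); under eq_bigr do rewrite path_sum_step A_diag mul0r add0r.
  by rewrite subrK.
apply: le_trans (ler_normD _ _) _; rewrite lerD2l.
apply: le_trans (ler_norm_sum _ _ _) _; apply: ler_sum => j _.
apply: le_trans (ler_norm_sum _ _ _) _; apply: ler_sum => w _.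
by rewrite normrM (ger0_norm (a_ge0 j u w)).
Qed.

Let sum_S : \sum_j S j <= r * F y.
Proof. exact: F_super. Qed.

Let rz_le : `|H U'| * (r * F y) <= `|z| * `|H U'| * F y.
Proof. by rewrite mulrCA mulrA ler_wpM2r ?(ltW (F_gt0 y)) // ler_wpM2r // ltW. Qed.

(** The neighbours of [y] in the copy of [A j] pay for [out j] and [G j], those in
    the other copies for the remaining terms of [H U]. *)
Lemma out_le j : u \in N j -> out j <= `|H U| * F y.
Proof.
move=> uN; have := H_bound; rewrite (bigD1 j) //=.
have := ler_wpM2l (normr_ge0 (H U')) sum_S; rewrite (bigD1 j) //= mulrDr.
have := out_bound uN; have := rz_le.
have : \sum_(k | k != j) G k <= `|H U'| * \sum_(k | k != j) S k.
  by rewrite mulr_sumr; apply: ler_sum => k _; apply: G_bound.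
lra.
Qed.

Lemma H_lower_bound : (`|z| - r) * `|H U'| * F y <= `|H U| * F y.
Proof.
have := H_bound; have := ler_wpM2l (normr_ge0 (H U')) sum_S.
have : \sum_j G j <= `|H U'| * \sum_j S j.
  by rewrite mulr_sumr; apply: ler_sum => k _; apply: G_bound.
lra.
Qed.

End Step.

Let escapeP U : escape_bound U.
Proof.
have [m] := ubnP #|U|; elim: m U => // m IHm U leUm y j yU yN.
apply: out_le => //; apply: IHm.
by move: leUm; rewrite (cardsD1 (last_vertex y)) yU.
Qed.

Lemma supersolution_neq0 (U : {set 'I_n}) : H U != 0.
Proof.
have [m] := ubnP #|U|; elim: m U => // m IHm U leUm.
have [->//|[u uU]] := set_0Vmem U; have [y yu] := last_onto u.
rewrite -normr_gt0 -(pmulr_lgt0 _ (F_gt0 y)); rewrite -yu in uU.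
apply: lt_le_trans (H_lower_bound uU (@escapeP _)).
rewrite !mulr_gt0 // ?subr_gt0 // normr_gt0; apply: IHm.
by move: leUm; rewrite (cardsD1 (last_vertex y)) uU.
Qed.

End Supersolution.

(** * The additive product *)

Section Strings.
Variables (c n : nat) (A : 'I_c -> 'M[int]_n) (v1 : 'I_n).
Hypothesis A_sym : forall j u v, A j u v = A j v u.
Hypothesis A_diag : forall j u, A j u u = 0.
Let N j := nonisolated (A j).
Let string := seq ('I_c * 'I_n).
Implicit Types (s b : string) (j : 'I_c) (u v w : 'I_n).

Definition end_vertex s : 'I_n := last v1 (unzip2 s).

Definition ends_with_colour j s : bool :=
  if rev s is (k, _) :: _ then k == j else false.

(** A copy of [A j] consists of a string [b], through which walks from the root
    enter the copy, and of the strings [rcons b (j, w)]; [b] itself sits above its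
    own end vertex. *)
Definition copy_entry j s : string :=
  if ends_with_colour j s then take (size s).-1 s else s.

Definition move j w s : string :=
  let b := copy_entry j s in if w == end_vertex b then b else rcons b (j, w).

Lemma end_vertex_rcons s j w : end_vertex (rcons s (j, w)) = w.
Proof. by rewrite /end_vertex /unzip2 map_rcons last_rcons. Qed.

Lemma ends_with_colour_rcons k s j w : ends_with_colour k (rcons s (j, w)) = (j == k).
Proof. by rewrite /ends_with_colour rev_rcons. Qed.

Lemma copy_entry_rcons s j w : copy_entry j (rcons s (j, w)) = s.
Proof.
by rewrite /copy_entry ends_with_colour_rcons eqxx size_rcons /= -cats1 take_size_cat.
Qed.

Lemma copy_entry_id s j : ~~ ends_with_colour j s -> copy_entry j s = s.
Proof. by rewrite /copy_entry => /negbTE ->. Qed.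

Lemma ends_with_colourP j s :
  reflect (exists b w, s = rcons b (j, w)) (ends_with_colour j s).
Proof.
apply: (iffP idP) => [|[b [w ->]]]; last by rewrite ends_with_colour_rcons.
case/lastP: s => [//|b [k w]]; rewrite ends_with_colour_rcons => /eqP ->.
by exists b, w.
Qed.

Lemma valid_string_rcons s j w : valid_string A v1 (rcons s (j, w)) =
  [&& valid_string A v1 s, ~~ ends_with_colour j s, end_vertex s != w,
      end_vertex s \in N j & w \in N j].
Proof.
rewrite /valid_string.
have -> : valid_steps A v1 (rcons s (j, w)) =
    [&& valid_steps A v1 s, end_vertex s != w, end_vertex s \in N j & w \in N j].
  rewrite /end_vertex; elim: s (v1) => [|[k u] s IHs] v /=; first by rewrite andbT.
  by rewrite IHs -!andbA.
have -> : sorted (fun C D => C != D) (unzip1 (rcons s (j, w))) =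
    sorted (fun C D => C != D) (unzip1 s) && ~~ ends_with_colour j s.
  case/lastP: s => [//|s [k u]]; rewrite ends_with_colour_rcons /unzip1 !map_rcons /=.
  case: (map _ s) => [|x p] /=; first by rewrite andbT.
  by rewrite rcons_path last_rcons.
by rewrite -!andbA; do !bool_congr.
Qed.

Lemma copy_entry_valid j s : valid_string A v1 s -> end_vertex s \in N j ->
  [/\ valid_string A v1 (copy_entry j s), ~~ ends_with_colour j (copy_entry j s)
    & end_vertex (copy_entry j s) \in N j].
Proof.
move=> s_valid sN; have [/ends_with_colourP[b [w sE]]|sj] := boolP (ends_with_colour j s).
  by move: s_valid; rewrite sE copy_entry_rcons valid_string_rcons => /and5P[].
by rewrite copy_entry_id.
Qed.

Lemma copy_entry_move j w s : valid_string A v1 s -> end_vertex s \in N j ->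
  copy_entry j (move j w s) = copy_entry j s.
Proof.
move=> s_valid sN; have [_ bj _] := copy_entry_valid s_valid sN.
by rewrite /move; case: ifP => _; rewrite ?copy_entry_rcons // copy_entry_id.
Qed.

Lemma move_valid j w s : valid_string A v1 s -> end_vertex s \in N j -> w \in N j ->
  valid_string A v1 (move j w s).
Proof.
move=> s_valid sN wN; have [b_valid bj bN] := copy_entry_valid s_valid sN.
rewrite /move; case: ifPn => // wb.
by rewrite valid_string_rcons b_valid bj bN wN eq_sym wb.
Qed.

Lemma end_vertex_move j w s : end_vertex (move j w s) = w.
Proof. by rewrite /move; case: eqP => [->|_]; rewrite ?end_vertex_rcons. Qed.

Lemma move_move j w w' s : valid_string A v1 s -> end_vertex s \in N j ->
  move j w' (move j w s) = move j w' s.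
Proof. by move=> sv sN; rewrite {1}/move copy_entry_move. Qed.

Lemma move_end_vertex j s : valid_string A v1 s -> move j (end_vertex s) s = s.
Proof.
move=> s_valid; have [/ends_with_colourP[b [w sE]]|sj] := boolP (ends_with_colour j s).
  move: s_valid; rewrite /move sE copy_entry_rcons end_vertex_rcons.
  by rewrite valid_string_rcons eq_sym => /and5P[_ _ /negbTE ->].
by rewrite /move copy_entry_id // eqxx.
Qed.

Lemma edge_nonisolated j u v : A j u v != 0 -> (u \in N j) * (v \in N j).
Proof.
move=> uv; rewrite !inE; split; apply/existsP; first by exists v; rewrite /edge A_sym.
by exists u.
Qed.

Lemma append_arc j w s : A j (end_vertex s) w != 0 ->
  product_arc A v1 s (rcons s (j, w)).
Proof.
case/lastP: s => [|s [k u]] uw; first exact: arc_root.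
by apply: arc_new_copy; rewrite /edge; rewrite end_vertex_rcons in uw.
Qed.

Lemma move_arc j w s : A j (end_vertex s) w != 0 ->
  product_arc A v1 s (move j w s) \/ product_arc A v1 (move j w s) s.
Proof.
have [/ends_with_colourP[b [u ->]]|sj] := boolP (ends_with_colour j s).
  rewrite /move copy_entry_rcons end_vertex_rcons => uw; case: eqP => [wE|_].
    by right; apply: append_arc; rewrite A_sym -wE.
  by left; apply: arc_same_copy.
move=> uw; rewrite /move copy_entry_id //; case: eqP => [wE|_].
  by rewrite wE A_diag in uw.
by left; apply: append_arc.
Qed.

(** A move within the copy that [s] entered last does not lengthen [s], while a
    move along another colour appends a letter recording the colour. *)
Lemma move_inj s j j' w w' : A j (end_vertex s) w != 0 ->
  A j' (end_vertex s) w' != 0 -> move j w s = move j' w' s -> (j, w) = (j', w').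
Proof.
move=> sw sw' E; have ww' : w = w'.
  by rewrite -(end_vertex_move j w s) E end_vertex_move.
rewrite -{}ww' in sw' E *; congr (_, _).
have fresh k : A k (end_vertex s) w != 0 -> ~~ ends_with_colour k s ->
    move k w s = rcons s (k, w).
  move=> kw ks; rewrite /move copy_entry_id //; case: eqP => // wE.
  by rewrite wE A_diag in kw.
have old k : ends_with_colour k s -> (size (move k w s) <= size s)%N.
  case/ends_with_colourP=> b [u ->]; rewrite /move copy_entry_rcons.
  by case: ifP => _; rewrite !size_rcons.
have [js|js] := boolP (ends_with_colour j s);
  have [j's|j's] := boolP (ends_with_colour j' s).
- case/ends_with_colourP: js j's => b [u ->].
  by rewrite ends_with_colour_rcons => /eqP.
- by have := old j js; rewrite E fresh // size_rcons ltnn.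
- by have := old j' j's; rewrite -E fresh // size_rcons ltnn.
- by move: E; rewrite !fresh // => /rcons_inj[].
Qed.

(** Any list that contains the neighbours and has a size independent of [s] bounds
    the number of walks. *)
Definition neighbour_candidates s : seq string :=
  let b := take (size s).-1 s in
  b :: codom (rcons s) ++ codom (rcons b).

Lemma size_neighbour_candidates s :
  size (neighbour_candidates s) = (#|{: 'I_c * 'I_n}|.*2).+1.
Proof. by rewrite /= size_cat !size_codom addnn. Qed.

Lemma neighbour_candidatesP s t : product_arc A v1 s t \/ product_arc A v1 t s ->
  t \in neighbour_candidates s.
Proof.
have prefix b x : take (size (rcons b x)).-1 (rcons b x) = b.
  by rewrite size_rcons /= -cats1 take_size_cat.
have same b x y : rcons b y \in neighbour_candidates (rcons b x).
  by rewrite inE mem_cat prefix codom_f ?orbT.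
have child b x : rcons b x \in neighbour_candidates b.
  by rewrite inE mem_cat codom_f ?orbT.
have parent b x : b \in neighbour_candidates (rcons b x).
  by rewrite inE prefix eqxx.
case=> [[b C u v _|b C u C' v _|C v _]|[b C u v _|b C u C' v _|C v _]] //.
exact: (child [::] (C, v)).
Qed.

End Strings.

(** * Counting walks in a locally finite graph *)

Section Walks.
Variables (V : choiceType) (e : rel V).
Implicit Types (u v y : V) (t : nat).

Definition walk_connected u v := exists2 p, path e u p & last u p = v.

Lemma walk_connected_refl u : walk_connected u u.
Proof. by exists [::]. Qed.

Lemma walk_connected_trans v u y :
  walk_connected u v -> walk_connected v y -> walk_connected u y.
Proof.
move=> [p up pv] [q vq qy]; exists (p ++ q); first by rewrite cat_path up pv.
by rewrite last_cat pv.
Qed.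

Lemma walk_connected_edge u v : e u v -> walk_connected u v.
Proof. by move=> uv; exists [:: v]; rewrite /= ?uv. Qed.

Lemma walk_connected_sym u v : symmetric e ->
  walk_connected u v -> walk_connected v u.
Proof.
move=> e_sym [p up <-]; exists (rev (belast u p)).
  rewrite rev_path; rewrite -(@eq_path _ e) // => x y; exact: e_sym.
by case: p up => //= x p _; rewrite rev_cons last_rcons.
Qed.

Variables (candidates : V -> seq V) (D : nat).
Hypothesis e_candidates : forall u v, e u v -> v \in candidates u.
Hypothesis size_candidates : forall u, (size (candidates u) <= D)%N.

(** An explicit list containing all walks of length [t]; it shows that there are
    finitely many of them, at most [D ^ t]. *)
Fixpoint candidate_walks t u : seq (seq V) :=
  if t is t'.+1 then
    [seq y :: w | y <- candidates u, w <- candidate_walks t' y]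
  else [:: [::]].

Lemma walks_candidate u v t w : walks e u v t w -> w \in candidate_walks t u.
Proof.
case=> <- + _; elim: w u => [|y w IHw] u /=; first by rewrite inE.
case/andP=> /e_candidates uy /IHw yw.
by apply/allpairsPdep; exists y, w.
Qed.

Lemma size_candidate_walks t u : (size (candidate_walks t u) <= D ^ t)%N.
Proof.
elim: t u => [|t IHt] u //=; rewrite size_allpairs_dep expnS.
apply: leq_trans (leq_mul (size_candidates u) (leqnn _)).
elim: (candidates u) => //= y s IHs; rewrite mulSn leq_add //.
Qed.

Lemma finite_walks u v t : finite_set (walks e u v t).
Proof.
apply: (sub_finite_set (B := [set` candidate_walks t u]%classic)).
  by move=> w /walks_candidate.
exact: finite_seq.
Qed.

Definition walk_seq u v t : seq (seq V) :=
  finmap.enum_fset (fset_set (walks e u v t)).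

Lemma size_walk_seq u v t : size (walk_seq u v t) = num_walks e u v t.
Proof. by []. Qed.

Lemma mem_walk_seq u v t w :
  (w \in walk_seq u v t) = [&& size w == t, path e u w & last u w == v].
Proof.
rewrite -[LHS]/(w \in fset_set _) in_fset_set; last exact: finite_walks.
apply/idP/and3P => [|[/eqP sw uw /eqP lw]]; first by move/set_mem => -[/= -> -> ->].
by apply/mem_set.
Qed.

Lemma walk_seq_uniq u v t : uniq (walk_seq u v t).
Proof. exact: finmap.fset_uniq. Qed.

Lemma num_walks_le u v t : (num_walks e u v t <= D ^ t)%N.
Proof.
apply: leq_trans (size_candidate_walks t u); rewrite -size_walk_seq.
apply: uniq_leq_size; first exact: walk_seq_uniq.
move=> w; rewrite mem_walk_seq => /and3P[/eqP sw uw /eqP lw].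
exact: (@walks_candidate u v).
Qed.

(** Walks through distinct neighbours are distinct. *)
Lemma num_walks_step (I : finType) (P : pred I) (g : I -> V) u v t :
    {in P &, injective g} -> (forall i, P i -> e u (g i)) ->
  (\sum_(i | P i) num_walks e (g i) v t <= num_walks e u v t.+1)%N.
Proof.
move=> g_inj ug; pose E := [seq g i :: w | i <- enum P, w <- walk_seq (g i) v t].
have -> : \sum_(i | P i) num_walks e (g i) v t = size E.
  rewrite size_allpairs_dep sumnE big_map big_enum /=.
  by apply: eq_bigr => i _; rewrite size_walk_seq.
rewrite -size_walk_seq; apply: uniq_leq_size.
  apply: allpairs_uniq_dep; rewrite ?enum_uniq //.
    by move=> i _; apply: walk_seq_uniq.
  move=> _ _ /allpairsPdep[i [w [iP _ ->]]] /allpairsPdep[k [w' [kP _ ->]]] /= [gik ->].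
  rewrite !mem_enum in iP kP.
  by rewrite (g_inj _ _ iP kP gik).
move=> _ /allpairsPdep[i [w [iP wE ->]]]; move: wE; rewrite !mem_walk_seq /=.
by rewrite mem_enum in iP; rewrite ug.
Qed.

Lemma num_walks_prepend u p v t : path e u p ->
  (num_walks e (last u p) v t <= num_walks e u v (size p + t))%N.
Proof.
elim: p u => //= y p IHp u /andP[uy /IHp]; rewrite addSn => le_y.
apply: leq_trans le_y _.
have := @num_walks_step unit predT (fun=> y) u v (size p + t).
rewrite (big_pred1 tt) => [|[]//]; apply; last by [].
by move=> [] [].
Qed.

Lemma num_walks_refl v : num_walks e v v 0 = 1%N.
Proof.
rewrite -size_walk_seq; apply/eqP; rewrite eqn_leq; apply/andP; split.
  rewrite -[1%N]/(size [:: [::] : seq V]); apply: uniq_leq_size; first exact: walk_seq_uniq.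
  by move=> w; rewrite mem_walk_seq size_eq0 inE => /andP[].
rewrite -[1%N]/(size [:: [::] : seq V]); apply: uniq_leq_size => // w.
by rewrite inE mem_walk_seq => /eqP ->; rewrite /= eqxx.
Qed.

End Walks.

(** * The Green function of a graph above its spectral radius *)

Section LimSup.
Variables (R : realType) (a : nat -> R) (M : R).
Hypothesis a_ge0 : forall t, 0 <= a t.
Hypothesis a_le : forall t, a t <= M.

Let a_bounded : bounded_fun (a : nat -> R^o).
Proof.
exists M; split; first exact: num_real.
move=> x Mx t _ /=; rewrite ger0_norm //; exact: le_trans (a_le t) (ltW Mx).
Qed.

Let le_sups t m : (m <= t)%N -> a t <= sups a m.
Proof.
move=> mt; apply: ub_le_sup; last by exists t.
by exists M => _ [k _ <-].
Qed.

Lemma limn_sup_nonneg : 0 <= limn_sup a.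
Proof.
rewrite (limn_supE a_bounded); apply: lb_le_inf.
  by exists (sups a 0); exists 0%N.
by move=> _ [m _ <-]; apply: le_trans (le_sups (leqnn m)).
Qed.

Lemma limn_sup_eventually_lt r : limn_sup a < r ->
  exists m, forall t, (m <= t)%N -> a t < r.
Proof.
rewrite (limn_supE a_bounded) => /inf_lt[].
  by exists (sups a 0); exists 0%N.
move=> _ [m _ <-] ltr; exists m => t mt.
exact: le_lt_trans (le_sups mt) ltr.
Qed.

End LimSup.

Section Green.
Variables (R : realType) (V : choiceType) (e : rel V).
Variables (candidates : V -> seq V) (D : nat).
Hypothesis e_candidates : forall u v, e u v -> v \in candidates u.
Hypothesis size_candidates : forall u, (size (candidates u) <= D)%N.
Variables (u v : V).

Let rho : R := spectral_radius R e u v.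

Let root_num_walks (t : nat) : R := (num_walks e u v t)%:R `^ (t%:R^-1).

Let root_ge0 t : 0 <= root_num_walks t.
Proof. exact: powR_ge0. Qed.

Let root_le t : root_num_walks t <= D.+1%:R.
Proof.
rewrite /root_num_walks; case: t => [|t].
  by rewrite invr0 powRr0 ler1n.
have le_D : (num_walks e u v t.+1)%:R <= D%:R ^+ t.+1 :> R.
  by rewrite -natrX ler_nat; apply: num_walks_le e_candidates size_candidates _ _ _.
have t_ge0 : 0 <= t.+1%:R^-1 :> R by rewrite invr_ge0.
apply: le_trans (ge0_ler_powR t_ge0 _ _ le_D) _; rewrite ?nnegrE //.
rewrite -powR_mulrn // -powRrM divff ?pnatr_eq0 // powRr1 //.
by rewrite ler_nat.
Qed.

Lemma spectral_radius_ge0 : 0 <= rho.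
Proof. exact: (limn_sup_nonneg root_ge0 root_le). Qed.

(** Undoing the [t]-th root needs [t] positive, hence a threshold [m.+1]. *)
Lemma num_walks_eventually_le (r : R) : rho < r ->
  exists m, forall t, (m <= t)%N -> (num_walks e u v t)%:R <= r ^+ t.
Proof.
move=> /(limn_sup_eventually_lt root_ge0 root_le)[m mP]; exists m.+1 => -[//|t] mt.
have {mt} : (m <= t.+1)%N by apply: ltnW.
move=> /mP /ltW; rewrite -/(root_num_walks t.+1) => le_r.
have -> : (num_walks e u v t.+1)%:R = root_num_walks t.+1 ^+ t.+1.
  by rewrite -powR_mulrn // -powRrM mulVf ?pnatr_eq0 // powRr1.
by apply: lerXn2r; rewrite ?nnegrE // (le_trans _ le_r).
Qed.

Definition green_term (r : R) (y : V) : nat -> R :=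
  fun t => (num_walks e y v t)%:R / r ^+ t.

Definition green (r : R) (y : V) : R := limn (series (green_term r y)).

Variable r : R.
Hypothesis rho_lt : rho < r.
Hypothesis u_connected : forall y, walk_connected e u y.
Hypothesis e_sym : symmetric e.

Let r_gt0 : 0 < r.
Proof. exact: le_lt_trans spectral_radius_ge0 rho_lt. Qed.

Let term_ge0 y t : 0 <= green_term r y t.
Proof. by rewrite divr_ge0 // exprn_ge0 // ltW. Qed.

(** Prepending a path from [u] to [y] bounds the walks from [y] by those from [u],
    which grow at most like the powers of some [r'] strictly below [r]. *)
Lemma green_cvg y : cvgn (series (green_term r y)).
Proof.
pose r' := (rho + r) / 2.
have rho_ge0 := spectral_radius_ge0.
have [rho_r' r'_r] : rho < r' /\ r' < r by rewrite /r'; split; move: rho_lt; lra.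
have r'_gt0 : 0 < r' by apply: le_lt_trans rho_r'.
have [m mP] := num_walks_eventually_le rho_r'.
have [p up py] := u_connected y.
pose q := r' / r; have q_gt0 : 0 < q by rewrite divr_gt0.
(* The finite sum absorbs the first [m] terms, for which there is no bound. *)
pose C := r' ^+ size p + \sum_(t < m) green_term r y t / q ^+ t.
have sum_ge0 : 0 <= \sum_(t < m) green_term r y t / q ^+ t.
  by apply: sumr_ge0 => t _; rewrite divr_ge0 // exprn_ge0 // ltW.
have C_ge0 : 0 <= C by rewrite addr_ge0 // exprn_ge0 // ltW.
apply: (@series_le_cvg _ _ (geometric C q)) => [t|t|t|].
- exact: term_ge0.
- by rewrite /= mulr_ge0 // exprn_ge0 // ltW.
- rewrite /= -ler_pdivrMr ?exprn_gt0 // /C; have [mt|tm] := leqP m t.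
    apply: ler_wpDr => //; rewrite ler_pdivrMr ?exprn_gt0 // /green_term /q.
    rewrite (expr_div_n r' r t) mulrA ler_wpM2r ?invr_ge0 ?exprn_ge0 ?(ltW r_gt0) //.
    rewrite -exprD; apply: le_trans (mP _ (leq_trans mt (leq_addl _ _))).
    by rewrite ler_nat -py; exact: (num_walks_prepend e_candidates).
  apply: ler_wpDl; first by rewrite exprn_ge0 // ltW.
  rewrite (bigD1 (Ordinal tm)) //= lerDl sumr_ge0 // => k _.
  by rewrite divr_ge0 // exprn_ge0 // ltW.
- apply: is_cvg_geometric_series; rewrite ger0_norm ?(ltW q_gt0) //.
  by rewrite ltr_pdivrMr // mul1r.
Qed.

Let series_le_green y t : series (green_term r y) t <= green r y.
Proof.
apply: nondecreasing_cvgn_le; last exact: green_cvg.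
by apply: nondecreasing_series => k _ _; exact: term_ge0.
Qed.

Lemma green_gt0 y : 0 < green r y.
Proof.
have yv : walk_connected e y v.
  exact: walk_connected_trans (walk_connected_sym e_sym (u_connected y)) (u_connected v).
have [p yp pv] := yv.
apply: lt_le_trans (series_le_green y (size p).+1).
rewrite /series /= big_nat_recr //=; apply: ltr_wpDl.
  by apply: sumr_ge0 => t _; exact: term_ge0.
rewrite divr_gt0 ?exprn_gt0 // ltr0n.
have := num_walks_prepend e_candidates v 0 yp.
by rewrite pv (num_walks_refl e_candidates) addn0.
Qed.

(** A walk from [y] of length [t + 1] starts with a step to a neighbour. *)
Lemma green_supersolution (I : finType) (P : pred I) (g : I -> V) y :
    {in P &, injective g} -> (forall i, P i -> e y (g i)) ->
  \sum_(i | P i) green r (g i) <= r * green r y.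
Proof.
move=> g_inj yg.
have cvg_sum : ((fun t => \sum_(i | P i) series (green_term r (g i)) t) @ \oo -->
    \sum_(i | P i) green r (g i))%classic.
  by apply: (cvg_big add_continuous) => i _; exact: green_cvg.
rewrite -(cvg_lim _ cvg_sum) //; apply: limr_le; first exact: cvgP cvg_sum.
apply: nearW => t.
apply: le_trans (ler_wpM2l (ltW r_gt0) (series_le_green y t.+1)).
rewrite /series /= exchange_big /= big_nat_recl // mulrDr.
apply: ler_wpDl; first by rewrite mulr_ge0 ?(ltW r_gt0).
rewrite mulr_sumr; apply: ler_sum => k _.
have -> : r * green_term r y k.+1 = (num_walks e y v k.+1)%:R / r ^+ k.
  by rewrite /green_term exprS; field; rewrite expf_neq0 gt_eqF.
rewrite /green_term -mulr_suml ler_wpM2r ?invr_ge0 ?exprn_ge0 ?(ltW r_gt0) //.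
by rewrite -natr_sum ler_nat; exact: (num_walks_step e_candidates v k g_inj yg).
Qed.

End Green.

(** * The walks of the additive product *)

Section Product.
Variables (c n : nat) (A : 'I_c -> 'M[int]_n) (v1 : 'I_n).
Hypothesis A_simple : forall j, simple_graph (A j).
Hypothesis H_connected : connected_graph (\sum_j A j).
Hypothesis A_connected : forall j, underline_nonempty_connected (A j).

Local Notation X := (product_vertex A v1).
Local Notation e := (@additive_product c n A v1).
Implicit Types (x y : X) (j : 'I_c) (u v w : 'I_n).

Let A_sym j u v : A j u v = A j v u.
Proof. by have [_ ->] := A_simple j. Qed.

Let A_diag j u : A j u u = 0.
Proof. by have [_ _ ->] := A_simple j. Qed.

Let A_ge0 j u v : 0 <= A j u v.
Proof. by have [/(_ u v)[->|->]] := A_simple j. Qed.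

Definition vertex_end y : 'I_n := end_vertex v1 (val y).

Definition vertex_move y j w : X := insubd y (move v1 j w (val y)).

Lemma val_vertex_move y j w : vertex_end y \in nonisolated (A j) ->
  w \in nonisolated (A j) -> val (vertex_move y j w) = move v1 j w (val y).
Proof.
by move=> yN wN; rewrite val_insubd move_valid //; exact: (valP y).
Qed.

Lemma vertex_end_move y j w : vertex_end y \in nonisolated (A j) ->
  w \in nonisolated (A j) -> vertex_end (vertex_move y j w) = w.
Proof. by move=> yN wN; rewrite /vertex_end val_vertex_move // end_vertex_move. Qed.

Lemma vertex_move_move y j w w' : vertex_end y \in nonisolated (A j) ->
    w \in nonisolated (A j) -> w' \in nonisolated (A j) ->
  vertex_move (vertex_move y j w) j w' = vertex_move y j w'.
Proof.
move=> yN wN w'N; apply: val_inj.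
rewrite !val_vertex_move ?vertex_end_move //.
exact: move_move (valP y) yN.
Qed.

Lemma vertex_move_end y j : vertex_end y \in nonisolated (A j) ->
  vertex_move y j (vertex_end y) = y.
Proof.
by move=> yN; apply: val_inj; rewrite val_vertex_move // (move_end_vertex _ (valP y)).
Qed.

Lemma additive_product_sym : symmetric e.
Proof. by move=> x y; apply/asboolP/asboolP => -[]; [right|left|right|left]. Qed.

Lemma vertex_move_edge y j w : A j (vertex_end y) w != 0 -> e y (vertex_move y j w).
Proof.
move=> yw; have [yN wN] := edge_nonisolated A_sym yw.
by apply/asboolP; rewrite val_vertex_move //; exact: move_arc.
Qed.

Lemma vertex_move_inj y :
  {in [pred p : 'I_c * 'I_n | A p.1 (vertex_end y) p.2 != 0] &,
    injective (fun p => vertex_move y p.1 p.2)}.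
Proof.
move=> [j w] [j' w']; rewrite !inE /= => yw yw' /(congr1 val).
have [yN wN] := edge_nonisolated A_sym yw.
have [yN' wN'] := edge_nonisolated A_sym yw'.
rewrite !val_vertex_move //; exact: move_inj.
Qed.

Definition product_candidates y : seq X :=
  pmap insub (neighbour_candidates (val y)).

Lemma product_candidatesP x y : e x y -> y \in product_candidates x.
Proof. by move=> /asboolP xy; rewrite mem_pmap_sub; exact: neighbour_candidatesP xy. Qed.

Lemma size_product_candidates y :
  (size (product_candidates y) <= (#|{: 'I_c * 'I_n}|.*2).+1)%N.
Proof. by rewrite size_pmap_sub -(size_neighbour_candidates (val y)) count_size. Qed.

(** Follow a path of [A j] between the two end vertices inside the copy. *)
Lemma copy_connected y j w : vertex_end y \in nonisolated (A j) ->
  w \in nonisolated (A j) -> walk_connected e y (vertex_move y j w).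
Proof.
move=> yN wN; have [_ /(_ _ _ yN wN)/connectP[p yp ->]] := A_connected j.
elim: p y yN {wN} yp => [|u p IHp] y yN /=.
  by rewrite vertex_move_end // => _; exact: walk_connected_refl.
case/andP=> /and3P[_ uN yu] up.
have := IHp (vertex_move y j u); rewrite vertex_end_move // => /(_ uN up).
have lN : last u p \in nonisolated (A j).
  by elim: p u uN up {IHp yu} => //= a p IHp u _ /andP[/and3P[_ aN _]]; exact: IHp.
rewrite vertex_move_move //; apply: walk_connected_trans.
exact/walk_connected_edge/vertex_move_edge.
Qed.

Lemma vertex_move_append y j w s : val y = rcons s (j, w) ->
  exists2 x, val x = s &
    [/\ vertex_end x \in nonisolated (A j), w \in nonisolated (A j)
      & y = vertex_move x j w].
Proof.
move=> yE; have := valP y; rewrite yE valid_string_rcons => /and5P[sv sj sw sN wN].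
exists (Sub s sv) => //; split=> //; apply: val_inj.
rewrite val_vertex_move //= yE /move copy_entry_id //.
by rewrite eq_sym (negbTE sw).
Qed.

Lemma product_connected x y : walk_connected e x y.
Proof.
pose root : X := Sub [::] (erefl : valid_string A v1 [::]).
have from_root z : walk_connected e root z.
  have [m] := ubnP (size (val z)); elim: m z => // m IHm z.
  case zE: (val z) / (lastP (val z)) => [|s [j w]].
    move=> _; have -> : z = root by apply: val_inj.
    exact: walk_connected_refl.
  rewrite size_rcons ltnS => lesm.
  have [z' z'E [z'N wN ->]] := vertex_move_append zE.
  by apply: walk_connected_trans (copy_connected z'N wN); apply: IHm; rewrite z'E.
exact: walk_connected_trans (walk_connected_sym additive_product_sym (from_root x)) _.
Qed.

(** Follow a path of the sum graph from [v1], moving along a colour of each edge. *)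
Lemma vertex_end_onto u : exists y, vertex_end y = u.
Proof.
have /connectP[p v1p ->] := H_connected v1 u.
pose root : X := Sub [::] (erefl : valid_string A v1 [::]).
suff reach v : path (edge (\sum_j A j)) v p -> (exists y, vertex_end y = v) ->
    exists y, vertex_end y = last v p by apply: reach v1p _; exists root.
elim: p v {v1p} => //= w p IHp v /andP[vw wp] [y yv]; apply: IHp wp _.
have [j jw] : exists j, A j v w != 0.
  apply/existsP; apply: contraNT vw => /existsPn A0.
  rewrite summxE big1 // => j _.
  by apply/eqP; have := A0 j; rewrite negbK.
have [vN wN] := edge_nonisolated A_sym jw.
by exists (vertex_move y j w); rewrite vertex_end_move // yv.
Qed.

Lemma additive_char_poly_root_le (R : realType) (x y : X) (z : R) :
  root (map_poly intr (additive_char_poly A)) z -> `|z| <= spectral_radius R e x y.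
Proof.
move=> /rootP; rewrite horner_additive_char_poly => z_root.
rewrite leNgt; apply/negP => rho_lt.
pose r := (spectral_radius R e x y + `|z|) / 2.
have [rho_r r_z] : spectral_radius R e x y < r /\ r < `|z|.
  by rewrite /r; split; move: rho_lt; lra.
pose F := green e y r.
have F_gt0 s : 0 < F s.
  exact: (green_gt0 product_candidatesP size_product_candidates rho_r
    (product_connected x) additive_product_sym).
have F_super s : \sum_j \sum_w (A j (vertex_end s) w)%:~R * F (vertex_move s j w) <= r * F s.
  have := green_supersolution product_candidatesP size_product_candidates rho_r
    (product_connected x) (@vertex_move_inj s)
    (fun p => @vertex_move_edge s p.1 p.2).
  rewrite pair_big /= big_mkcond; apply: le_trans; apply: ler_sum => -[j w] _ /=.
  by have [/(_ (vertex_end s) w)[->|->] _ _] := A_simple j; rewrite ?mul0r ?mul1r.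
move/eqP: z_root; apply/negP.
apply: (supersolution_neq0 A_sym A_ge0 A_diag vertex_end_move vertex_move_move
  vertex_move_end vertex_end_onto F_gt0 F_super r_z
  (H := fun U => heap_sum A setT U (fun=> z))).
  by rewrite heap_sum_set0 oner_neq0.
move=> U v vU; rewrite {1}(heap_sum_step _ _ _ vU); congr (_ - _).
by apply: eq_bigl => j; rewrite inE.
Qed.

End Product.

(** * The roots of the additive characteristic polynomial *)

Theorem theorem4p26 (R : realType) (n c : nat) (A : 'I_c -> 'M[int]_n)
    (v1 : 'I_n)
    (A_simple : forall j, simple_graph (A j))
    (H_connected : connected_graph (\sum_j A j))
    (A_connected : forall j, underline_nonempty_connected (A j))
    (u v : product_vertex A v1) (z : R[i])
    (z_root : root (map_poly intr (additive_char_poly A)) z) :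
  let rho : R := spectral_radius R (@additive_product c n A v1) u v in
  exists2 x : R, z = x%:C & x \in `[- rho, rho].
Proof.
have z_real : complex.Im z = 0.
  by apply: additive_char_poly_real_rooted z_root => j; have [] := A_simple j.
exists (complex.Re z); first by case: z z_real {z_root} => a b /= ->.
rewrite in_itv /= -ler_norml; apply: additive_char_poly_root_le => //.
rewrite -(fmorph_root (real_complex R)) -map_poly_comp.
have -> : map_poly (real_complex R \o intr) (additive_char_poly A) =
          map_poly intr (additive_char_poly A).
  by apply: eq_map_poly => k; rewrite /= rmorph_int.
by case: z z_real z_root => a b /= ->.
Qed.
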